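(* Let $n\ge 1$ and let $\lambda$ be a partition of $n$ with $l$ parts, and for each $i\ge1$ let $n_i$ be the number of parts of $\lambda$ equal to $i$. Let $S_\lambda$ be the set of dissections of a regular $(n+2)$-gon by noncrossing diagonals such that the multiset of numbers of sides of the pieces is $\{\lambda_1+2,\dots,\lambda_l+2\}$ (i.e. for each $i$ there are exactly $n_i$ pieces which are $(i+2)$-gons), and let $C_{n+2}$ act on $S_\lambda$ by rotation of the polygon (a generator rotating by one vertex). Let \[ \mu_\lambda(q)=\frac{1}{[n+1]_q}\begin{bmatrix} n+l\\ n_1,n_2,\dots,n_n,n\end{bmatrix}_q . \] Then $(S_\lambda, C_{n+2},\mu_\lambda(q))$ exhibits the cyclic sieving phenomenon.
   Context: $[a]_q=1+q+\dots+q^{a-1}$, $[a]_q!=[1]_q\cdots[a]_q$, and $\begin{bmatrix} N\\ a_1,\dots,a_r\end{bmatrix}_q=\frac{[N]_q!}{[a_1]_q!\cdots[a_r]_q!}$ when $a_1+\dots+a_r=N$. A triple $(S,C,P(q))$ with $C$ a finite cyclic group acting on a finite set $S$ exhibits the cyclic sieving phenomenon if for every $g\in C$ of order $d$, $P(e^{2i\pi/d})$ equals the number of elements of $S$ fixed by $g$. (In the paper, $S_\lambda$ is the set of faces of the cluster complex of type $A_{n-1}$ of parabolic type $\lambda$, i.e. of type $\prod_i\mathfrak{S}_{\lambda_i}$, and the rotation is the Fomin–Zelevinsky rotation.) *)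

(* Defs.v *)
From HB Require Import structures.
From mathcomp Require Import all_boot all_order all_algebra all_fingroup.
From mathcomp Require Import cyclic fraction reals trigo complex.

Set Implicit Arguments.
Unset Strict Implicit.
Unset Printing Implicit Defensive.

Import GRing.Theory.

Local Open Scope ring_scope.

Definition is_partition (n : nat) (la : seq nat) : bool :=
  [&& sorted geq la, all (leq 1) la & sumn la == n].

(* q-analogues, as polynomials in q = 'X. *)

Definition qint (a : nat) : {poly int} := \sum_(i < a) 'X^i.

Definition qfact (a : nat) : {poly int} := \prod_(1 <= i < a.+1) qint i.

(* Meant for N = sumn a. The value is a rational function of q; that it is a
   polynomial is a theorem, so the quotient is taken in the fraction field. *)
Definition qmultinomial (N : nat) (a : seq nat) : {fraction {poly int}} :=
  tofrac (qfact N) / \prod_(k <- a) tofrac (qfact k).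

Definition mu (n : nat) (la : seq nat) : {fraction {poly int}} :=
  (tofrac (qint n.+1))^-1 *
  qmultinomial (n + size la)
    (rcons [seq count_mem i la | i <- iota 1 n] n).

(* e^{2 i pi / d} *)
Definition root_unity (R : realType) (d : nat) : R[i] :=
  Complex (cos (2 * pi / d%:R)) (sin (2 * pi / d%:R)).

Definition cyclic_sieving (R : realType) (gT : finGroupType) (T : finType)
    (to : {action gT &-> T}) (S : {set T}) (C : {group gT})
    (P : {poly int}) : Prop :=
  [/\ cyclic C,
      [acts C, on S | to] &
      forall g, g \in C ->
        (map_poly intr P).[root_unity R #[g]%g] = #|'Fix_(S | to)[g]%g|%:R].

(* The vertices of the regular (n+2)-gon, in counterclockwise order, are the
   elements of 'I_n.+2, whose canonical group structure is addition modulo n+2.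
   A chord is a two-element set of vertices, and a convex polygon inscribed in
   the (n+2)-gon is given by its set of vertices. *)
Section Dissections.
Variable n : nat.
Local Notation vertex := 'I_n.+2.

(* Going counterclockwise from a, one meets x strictly before b; the
   differences are taken modulo n+2. *)
Definition between (a x b : vertex) : bool :=
  (0 < val (x - a)%R < val (b - a)%R)%N.

Definition sides (A : {set vertex}) : {set {set vertex}} :=
  [set [set a; b] | a in A, b in A &
     (a != b) && [forall x in A, ~~ between a x b]].

Definition diagonals (A : {set vertex}) : {set {set vertex}} :=
  [set e : {set vertex} | (e \subset A) && (#|e| == 2)] :\: sides A.

Definition crossing (e f : {set vertex}) : bool :=
  [exists a, exists b, exists c, exists d,
    [&& e == [set a; b], f == [set c; d], between a c b & between b d a]].

Definition dissection (D : {set {set vertex}}) : bool :=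
  (D \subset diagonals setT) &&
  [forall e in D, forall f in D, ~~ crossing e f].

(* The pieces of D: the polygons bounded by diagonals of D and sides of the
   (n+2)-gon that are not cut by any diagonal of D. As D is noncrossing, a
   diagonal in D can only cut such a polygon along one of its own diagonals. *)
Definition pieces (D : {set {set vertex}}) : {set {set vertex}} :=
  [set A : {set vertex} |
    [&& (2 < #|A|)%N, sides A \subset sides setT :|: D
      & [disjoint diagonals A & D]]].

Definition dissections_of_type (la : seq nat) : {set {set {set vertex}}} :=
  [set D | dissection D &
     perm_eq [seq #|A| | A : {set vertex} in pieces D]
             [seq k.+2 | k <- la]].

(* Translation of the vertices by 'I_n.+2, acting on sets of chords. *)
Definition rotation : {action 'I_n.+2 &-> {set {set vertex}}} :=
  ((('R)^*)^*)%act.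

End Dissections.

(* Main.v *)
(** An arc [(v, L)] on a circle with [m] points runs from [v] to [v + L].  In a
    noncrossing family of arcs, give each arc as label the number of points of
    which it is the innermost cover, and list at each point the labels of the
    arcs starting there, by increasing length.  All labels inside an arc [(v, L)]
    add up to [L - 1], so each length is recovered as a first passage, and the
    families with label multiset [nu], [sumn nu < m], correspond to the words
    with [m] separators, the first letter being one, and letters [nu].
    There are [(m - 1 + |nu|)! / ((m - 1)! * prod_i nu_i!)] of them.

    In a dissection whose diagonals form such a family, an arc of label [l] cuts
    off a piece with [l + 2] vertices, and the uncovered points form the one
    remaining piece, if there are at least 3 of them.  If [n + 2 = d * m] with
    [d > 1], every diagonal of a dissection invariant under rotation by [m] has
    length at most [m] on the side away from the centre, so these dissections
    are the families of arcs on a circle with [m] points.  For [d = 1], cutting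
    the polygon at its root side gives the families on a circle with [n + 1]
    points that leave only the point [0] uncovered, which by rotation are a
    fraction [1 / (n + 1)] of all families with label sum [n].

    The product formula [[a]! = prod_(e >= 2) Phi_e ^ (a / e)] shows that [mu] is
    a polynomial; its values at roots of unity of order [d] follow from writing
    [[a]! = [d] ^ (a / d) * V] with [V] nonzero there. *)
Require Import Defs.
From mathcomp Require Import all_boot all_order all_algebra all_fingroup.
From mathcomp Require Import all_field cyclic.
From mathcomp Require Import fraction boolp reals trigo complex.
From mathcomp Require Import zify ring.

Set Implicit Arguments.
Unset Strict Implicit.
Unset Printing Implicit Defensive.

Import Order.TTheory GRing.Theory Num.Theory.

(** * Families of noncrossing arcs on a circle *)

(** Both sides of the sieving identity depend on the multiplicities of the parts through their
    quotients and remainders modulo [d]. A rotation of order [d > 1] permutes the pieces in orbits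
    of size [d], except for at most one central piece, so an invariant dissection of the given type
    exists only if the remainders add up to at most 1. On the side of the polynomial,
    [n = (m - 1) d + d - 2], so remainders with sum at least 2 carry the numerator past the next
    multiple of [d], and a factor [[d]] survives. Remainder sum 0 is the case of a central diameter,
    which forces [d = 2]. Such a diameter is a loop on the small circle, one of the two uses of
    loops; the other is the root side.

    Counting on a circle instead of a line makes the label words free: no ballot condition remains,
    only the bound on the sum of the letters. For [d = 1] there is no smaller circle to pass to, and
    the root side takes the place of the symmetry.

    Counts and evaluations are kept as undivided products, so that they are compared by cancelling
    the same positive integer. *)

(* The arc from [v] to [v + L] around the circle, with [v] taken modulo [m];
   [L = m] is a loop. *)
Definition arc_family (m : nat) (F : nat -> nat -> bool) : Prop :=
  [/\ forall v L, F (v + m) L = F v L,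
      forall v L, F v L -> 1 < L <= m
    & forall v L t L', F v L -> 0 < t < L -> F (v + t) L' -> t + L' <= L].

(* [(v, L)] is the innermost arc strictly around the point [v + t]. *)
Definition innermost_at (F : nat -> nat -> bool) (v L t : nat) : bool :=
  [forall s : 'I_t, forall L' : 'I_L.+1,
     F (v + s) L' && (t < s + L') ==> (s == 0 :> nat) && (L' == L :> nat)].

Definition label F v L := \sum_(1 <= t < L) innermost_at F v L t.

Definition arcs_at m (F : nat -> nat -> bool) v := [seq L <- iota 0 m.+1 | F v L].

Definition labels_at m F v := [seq label F v L | L <- arcs_at m F v].

Lemma arcs_at_widen m M (F : nat -> nat -> bool) v :
  (forall L, F v L -> L <= m) -> m <= M -> arcs_at M F v = arcs_at m F v.
Proof.
move=> Fm mM; rewrite /arcs_at (_ : M.+1 = m.+1 + (M - m)); last lia.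
rewrite iotaD filter_cat [X in _ ++ X](_ : _ = [::]) ?cats0 //.
apply/eqP; rewrite -[_ == _]negbK -has_filter; apply/hasPn => L.
by rewrite mem_iota => L_gt; apply/negP => /Fm; lia.
Qed.

Section Family.
Variables (m : nat) (F : nat -> nat -> bool).
Hypothesis famF : arc_family m F.

Let Fper v L : F (v + m) L = F v L. Proof. by case: famF. Qed.
Let Flen v L : F v L -> 1 < L <= m. Proof. by case: famF => _ + _; apply. Qed.
Let Fnc v L t L' : F v L -> 0 < t < L -> F (v + t) L' -> t + L' <= L.
Proof. by case: famF => _ _; apply. Qed.

(** The Boolean test looks only at arcs of length at most [L]. A longer arc starting strictly inside
    [(v, L)] is excluded by noncrossing, and a longer one at [v] does no harm. *)
Lemma innermost_atP v L t : F v L -> t < L ->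
  reflect (forall s L', s < t -> t < s + L' -> F (v + s) L' -> s = 0 /\ L <= L')
          (innermost_at F v L t).
Proof.
move=> FvL tL; apply: (iffP forallP) => [fr s L' st tsL FsL | fr s].
  have [LL'|L'L] := ltnP L L'.
    have [s0|s_gt0] := posnP s; first by split=> //; lia.
    have := @Fnc v L s L' FvL; lia.
  have /forallP/(_ (Ordinal (_ : L' < L.+1))) := fr (Ordinal st).
  by move=> /(_ L'L) /=; rewrite FsL tsL /= => /andP[/eqP-> /eqP->].
apply/forallP => L'; apply/implyP => /andP[FsL tsL].
have [s0 LL'] := fr s L' (ltn_ord s) tsL FsL.
have := ltn_ord L'; lia.
Qed.

Lemma mem_arcs_at v L : (L \in arcs_at m F v) = F v L.
Proof.
rewrite mem_filter mem_iota; case FvL: (F v L) => //=.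
by have := Flen FvL; lia.
Qed.

Lemma arcs_at_sorted v : sorted ltn (arcs_at m F v).
Proof. by apply: sorted_filter; [exact: ltn_trans | exact: iota_ltn_sorted]. Qed.

(** Among the arcs around [v + t], take the latest start and then the shortest length. The given arc
    at [v + s] keeps the result inside the window of starts from [s] on. *)
Lemma innermost_exists v s L t : F (v + s) L -> s < t < s + L ->
  exists s1 L1, [/\ s <= s1 < t, t < s1 + L1, F (v + s1) L1,
     s1 = s -> L1 <= L & innermost_at F (v + s1) L1 (t - s1)].
Proof.
move=> FsL stL.
pose P s1 := (s <= s1 < t) && has (fun L1 => F (v + s1) L1 && (t < s1 + L1)) (iota 0 m.+1).
have exP : exists s1, P s1.
  exists s; apply/andP; split; first lia.
  apply/hasP; exists L; last by rewrite FsL; lia.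
  by rewrite mem_iota; have := Flen FsL; lia.
have ubP s1 : P s1 -> s1 <= t by case/andP; lia.
case: (ex_maxnP exP ubP) => s1 /andP[ss1 /hasP[L0 _ /andP[FL0 tL0]]] s1max.
pose Q L1 := F (v + s1) L1 && (t < s1 + L1).
have exQ : exists L1, Q L1 by exists L0; rewrite /Q FL0.
case: (ex_minnP exQ) => L1 /andP[FL1 tL1] L1min.
exists s1, L1; split=> //.
  move=> e; apply: L1min; rewrite /Q e FsL; lia.
apply/innermost_atP => //; first lia.
move=> s2 L2 s2t tsL2 F2.
have s20 : s2 = 0.
  have : s1 + s2 <= s1; last lia.
  apply: s1max; apply/andP; split; first lia.
  apply/hasP; exists L2; last by rewrite addnA F2; lia.
  by rewrite mem_iota; have := Flen F2; lia.
split=> //; apply: L1min; rewrite /Q; move: F2; rewrite s20 addn0 => ->; lia.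
Qed.

(** The arc that starts later competes with the other one, so the starts agree; then each length
    bounds the other. *)
Lemma innermost_unique v t s1 L1 s2 L2 :
  F (v + s1) L1 -> F (v + s2) L2 -> s1 < t < s1 + L1 -> s2 < t < s2 + L2 ->
  innermost_at F (v + s1) L1 (t - s1) -> innermost_at F (v + s2) L2 (t - s2) ->
  s1 = s2 /\ L1 = L2.
Proof.
move=> F1 F2 t1 t2 /innermost_atP fr1 /innermost_atP fr2.
have {}fr1 : forall s L', s < t - s1 -> t - s1 < s + L' -> F (v + s1 + s) L' ->
  s = 0 /\ L1 <= L' by apply: fr1 => //; lia.
have {}fr2 : forall s L', s < t - s2 -> t - s2 < s + L' -> F (v + s2 + s) L' ->
  s = 0 /\ L2 <= L' by apply: fr2 => //; lia.
have [le12|/ltnW le21] := leqP s1 s2.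
  have e : v + s1 + (s2 - s1) = v + s2 by lia.
  have [] : s2 - s1 = 0 /\ L1 <= L2 by apply: fr1; rewrite ?e //; lia.
  move=> s12 L12; have s21 : s1 = s2 by lia.
  have [] : 0 = 0 /\ L2 <= L1; last lia.
  by apply: fr2; rewrite ?addn0 -?s21 //; lia.
have e : v + s2 + (s1 - s2) = v + s1 by lia.
have [] : s1 - s2 = 0 /\ L2 <= L1 by apply: fr2; rewrite ?e //; lia.
move=> s12 L12; have s21 : s1 = s2 by lia.
have [] : 0 = 0 /\ L1 <= L2; last lia.
by apply: fr1; rewrite ?addn0 ?s21 //; lia.
Qed.

Lemma sum_labels_at v : sumn (labels_at m F v) = \sum_(0 <= L < m.+1 | F v L) label F v L.
Proof. by rewrite sumnE big_map big_filter /index_iota subn0. Qed.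

(* The labels of the arcs at [v] up to length [L] and of all arcs starting
   strictly between [v] and [v + x]. *)
Definition label_weight v L x :=
  \sum_(0 <= L' < L.+1 | F v L') label F v L' +
  \sum_(1 <= s < x) sumn (labels_at m F (v + s)).

(** For fixed [t], the arcs counted in [label_weight v L x] whose label includes the point
    [v + t]. *)
Definition inner v L x t : pred ('I_x * 'I_m.+1) := fun p =>
  [&& F (v + p.1) p.2, (p.1 == 0 :> nat) ==> (p.2 <= L), p.1 < t < p.1 + p.2
    & innermost_at F (v + p.1) p.2 (t - p.1)].

Arguments inner : clear implicits.

(** Double counting of pairs of an arc and a point of its label. An arc starting in the window has
    length at most [m], so [x + m] bounds the points that can occur. *)
Lemma label_weight_card v L x : 0 < x -> L <= m ->
  label_weight v L x = \sum_(0 <= t < x + m) #|inner v L x t|.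
Proof.
move=> x_gt0 Lm.
transitivity (\sum_(s < x) \sum_(L' < m.+1 | F (v + s) L' && ((s == 0 :> nat) ==> (L' <= L)))
  label F (v + s) L').
  case: x x_gt0 => // x _; rewrite big_ord_recl /= addn0 /label_weight; congr (_ + _).
    rewrite -(big_mkord (fun L' => F v L' && (L' <= L)) (label F v)).
    rewrite (big_nat_widen 0 L.+1 m.+1) ?ltnS //.
  rewrite big_add1 big_mkord; apply: eq_bigr => s _.
  rewrite sum_labels_at big_mkord; apply: eq_bigl => L'.
  by rewrite andbT /bump add1n.
pose c s (L' : nat) t := (s < t < s + L') && innermost_at F (v + s) L' (t - s).
transitivity (\sum_(s < x) \sum_(L' < m.+1 | F (v + s) L' && ((s == 0 :> nat) ==> (L' <= L)))
  \sum_(0 <= t < x + m) c s L' t).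
  apply: eq_bigr => s _; apply: eq_bigr => L' /andP[/Flen L'm _].
  rewrite (@big_cat_nat _ _ _ s.+1) /=; [|lia|have := ltn_ord s; lia].
  rewrite big_nat big1 ?add0n; last by move=> t ?; rewrite /c; case: ltnP => //; lia.
  rewrite (@big_cat_nat _ _ _ (s + L')) /=; [|lia|have := ltn_ord s; lia].
  rewrite [X in _ = _ + X]big_nat [X in _ = _ + X]big1 ?addn0; last first.
    by move=> t ?; rewrite /c; case: (ltnP t) => //; [lia | rewrite andbF].
  rewrite -[s.+1]add1n big_addn addKn /label.
  rewrite big_nat [RHS]big_nat; apply: eq_bigr => t tL; rewrite /c addnK.
  by rewrite (_ : (_ < _ < _) = true) //; lia.
rewrite (eq_bigr (fun s : 'I_x => \sum_(0 <= t < x + m) \sum_(L' < m.+1 |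
   F (v + s) L' && ((s == 0 :> nat) ==> (L' <= L))) c s L' t)); last first.
  by move=> s _; rewrite exchange_big.
rewrite exchange_big; apply: eq_bigr => t _ /=.
rewrite -sum1_card pair_big_dep /= big_mkcond [RHS]big_mkcond; apply: eq_bigr => -[s L'] _ /=.
rewrite /inner unfold_in /= /c.
by case: (F _ _) => //=; case: (_ ==> _) => //=; case: (_ && _).
Qed.

Lemma inner_le1 v L x t : #|inner v L x t| <= 1.
Proof.
apply/card_le1_eqP => -[s1 L1] [s2 L2]; rewrite !unfold_in.
move=> /and4P[/= F1 _ t1 f1] /and4P[/= F2 _ t2 f2].
by case: (innermost_unique F2 F1 t2 t1 f2 f1) => /val_inj-> /val_inj->.
Qed.

Lemma inner_gt0 v L x t : F v L -> 0 < t < L -> t <= x -> 0 < #|inner v L x t|.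
Proof.
move=> FvL tL tx; have Fv0 : F (v + 0) L by rewrite addn0.
have [s1 [L1 [st1 tL1 F1 le1 fr1]]] := innermost_exists Fv0 (tL : 0 < t < 0 + L).
have s1x : s1 < x by lia.
have L1m : L1 < m.+1 by have := Flen F1; lia.
apply/card_gt0P; exists (Ordinal s1x, Ordinal L1m); apply/and4P; split=> //=; last lia.
by apply/implyP => /eqP.
Qed.

(** Noncrossing keeps the counted arcs within [(v, L)], so only its [L - 1] inner points contribute,
    and each has exactly one innermost arc. *)
Lemma label_weight_eq v L : F v L -> label_weight v L L = L.-1.
Proof.
move=> FvL; have Lm := Flen FvL; rewrite label_weight_card; [|lia..].
have e0 t : ~~ (0 < t < L) -> #|inner v L L t| = 0.
  move=> tL; apply: eq_card0 => -[s L']; apply/negP; rewrite unfold_in.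
  move=> /and4P[/= FL' s0 tL' _]; have := ltn_ord s.
  have [s00|s_gt0] := posnP s; first by move: s0; rewrite s00; lia.
  by have := Fnc FvL (_ : 0 < s < L) FL'; lia.
rewrite (@big_cat_nat _ _ _ 1) /=; [|lia..].
rewrite big_nat1 e0 // add0n (@big_cat_nat _ _ _ L) /=; [|lia..].
rewrite [X in _ + X]big_nat [X in _ + X]big1 ?addn0; last by move=> t ?; apply: e0; lia.
transitivity (\sum_(1 <= t < L) 1); last by rewrite sum_nat_const_nat; lia.
rewrite big_nat [RHS]big_nat; apply: eq_bigr => t tL; apply/eqP.
by rewrite eqn_leq inner_le1 inner_gt0 //; lia.
Qed.

(** The points [v + 1] to [v + x] lie inside [(v, L)], and the innermost arc of each starts before
    it, hence in the window. So no smaller [x] passes the test by which the length is recovered. *)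
Lemma label_weight_ge v L x : F v L -> 0 < x < L -> x <= label_weight v L x.
Proof.
move=> FvL xL; have Lm := Flen FvL; rewrite label_weight_card; [|lia..].
rewrite (@big_cat_nat _ _ _ 1) /=; [|lia..].
rewrite (@big_cat_nat _ _ _ x.+1 1) /=; [|lia..].
apply: (@leq_trans (\sum_(1 <= t < x.+1) #|inner v L x t|)); last lia.
have {1}-> : x = \sum_(1 <= t < x.+1) 1 by rewrite sum_nat_const_nat; lia.
rewrite big_nat [X in _ <= X]big_nat; apply: leq_sum => t tx.
by apply: inner_gt0; lia.
Qed.

(** The end of the longest shorter arc at [v], or [v + 1] if there is none, has [(v, L)] as
    innermost arc. Positive labels leave the letter [0] free to serve as separator. *)
Lemma label_gt0 v L : F v L -> 0 < label F v L.
Proof.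
move=> FvL; have L_gt1 := Flen FvL.
pose P L' := (L' == 1) || F v L' && (L' < L).
have exP : exists L', P L' by exists 1.
have ubP L' : P L' -> L' <= L.-1 by case/orP => [/eqP->|/andP[_]]; lia.
case: (ex_maxnP exP ubP) => t Pt tmax.
have tL := ubP _ Pt; have t_gt0 : 0 < t by apply: tmax.
have frt : innermost_at F v L t.
  apply/innermost_atP => //; first lia.
  move=> s L' st tsL' FL'; have s0 : s = 0.
    case/orP: Pt => [/eqP t1|/andP[Fvt _]]; first lia.
    by case: s st tsL' FL' => // s st tsL' FL'; have := Fnc Fvt (_ : 0 < s.+1 < t) FL'; lia.
  split=> //; rewrite leqNgt; apply/negP => L'L.
  have : L' <= t; last lia.
  by apply: tmax; rewrite /P L'L; move: FL'; rewrite s0 addn0 => ->; rewrite orbT.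
rewrite /label (@big_cat_nat _ _ _ t) /=; [|lia..].
by rewrite (@big_ltn _ _ _ t) ?frt; lia.
Qed.

Lemma labels_at_per v : labels_at m F (v + m) = labels_at m F v.
Proof.
rewrite /labels_at /arcs_at (eq_filter (Fper v)); apply: eq_map => L.
rewrite /label; apply: eq_bigr => t _; congr nat_of_bool.
rewrite /innermost_at; apply: eq_forallb => s; apply: eq_forallb => L'.
by rewrite addnAC Fper.
Qed.

Lemma take_arcs_at v j : j < size (arcs_at m F v) ->
  take j.+1 (arcs_at m F v) = [seq L <- iota 0 (nth 0 (arcs_at m F v) j).+1 | F v L].
Proof.
move=> js; set L := nth _ _ _; have srt := arcs_at_sorted v.
have FvL : F v L by rewrite -mem_arcs_at mem_nth.
apply: (irr_sorted_eq ltn_trans ltnn); first exact: take_sorted.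
  by apply: sorted_filter; [exact: ltn_trans | exact: iota_ltn_sorted].
move=> L'; rewrite mem_filter mem_iota add0n leq0n /= ltnS.
apply/idP/andP => [|[FvL' L'L]].
  case/(nthP 0) => i; rewrite size_takel // => ij; rewrite nth_take // => <-.
  split; first by rewrite -mem_arcs_at mem_nth // /=; lia.
  have [/eqP->//|nij] := boolP (i == j).
  by rewrite ltnW // /L (sorted_ltn_nth ltn_trans) ?inE //; lia.
have /(nthP 0)[i isz iE] : L' \in arcs_at m F v by rewrite mem_arcs_at.
have ij : i < j.+1.
  rewrite ltnS leqNgt; apply/negP => ji; have : L < L'; last lia.
  by rewrite -iE /L (sorted_ltn_nth ltn_trans) ?inE.
by rewrite -iE -(nth_take 0 ij) mem_nth // size_takel.
Qed.

Lemma label_weight_take v j x : j < size (arcs_at m F v) ->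
  label_weight v (nth 0 (arcs_at m F v) j) x =
  sumn (take j.+1 (labels_at m F v)) + \sum_(1 <= s < x) sumn (labels_at m F (v + s)).
Proof.
move=> js; congr (_ + _).
by rewrite -map_take (take_arcs_at js) sumnE big_map big_filter /index_iota subn0.
Qed.

End Family.

(* The [j]-th arc at [v], counted from 1, has the least length [L] that exceeds
   the sum of its own label, those of the shorter arcs at [v] and those of the
   arcs starting strictly between [v] and [v + L]. *)
Definition fits (c : nat -> seq nat) v j L :=
  sumn (take j (c v)) + \sum_(1 <= s < L) sumn (c (v + s)) < L.

Definition arc_length m c v j := find (fits c v j) (iota 0 m.+1).

Definition arcs_of m c v L :=
  has (fun j => arc_length m c v j == L) (iota 1 (size (c v))).

Lemma arc_lengthP m c v j L : fits c v j L -> L <= m ->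
  (forall x, x < L -> ~~ fits c v j x) -> arc_length m c v j = L.
Proof.
move=> fL Lm minL; apply/eqP; rewrite eqn_leq; apply/andP; split.
  rewrite leqNgt; apply/negP => /(before_find 0).
  by rewrite nth_iota ?add0n ?fL //; lia.
rewrite leqNgt; apply/negP => lt_L; have/negP[] := minL _ lt_L.
have h : has (fits c v j) (iota 0 m.+1).
  by apply/hasP; exists L => //; rewrite mem_iota; lia.
have := nth_find 0 h; rewrite nth_iota //; rewrite -[X in _ < X](size_iota 0).
by rewrite -has_find.
Qed.

(** By [label_weight_eq] the true length fits, and by [label_weight_ge] nothing shorter does. *)
Lemma arc_length_labels m F v j : arc_family m F ->
  j < size (arcs_at m F v) ->
  arc_length m (labels_at m F) v j.+1 = nth 0 (arcs_at m F v) j.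
Proof.
move=> famF js; set L := nth _ _ _.
have FvL : F v L by rewrite -(mem_arcs_at famF) mem_nth.
have [_ Flen _] := famF; have Lm := Flen _ _ FvL.
have fitsE x : fits (labels_at m F) v j.+1 x = (label_weight m F v L x < x).
  by rewrite /L (label_weight_take famF).
apply: arc_lengthP; first by rewrite fitsE (label_weight_eq famF) //; lia.
  by case/andP: Lm.
move=> x xL; rewrite fitsE -leqNgt; case: x xL => // x xL.
exact: (label_weight_ge famF FvL).
Qed.

Lemma arcs_of_labels m F v L : arc_family m F ->
  arcs_of m (labels_at m F) v L = F v L.
Proof.
move=> famF; rewrite -(mem_arcs_at famF); apply/hasP/(nthP 0) => [[j]|[j js jL]].
  rewrite mem_iota size_map; case: j => // j /andP[_]; rewrite add1n ltnS => js.
  by rewrite (arc_length_labels famF js) => /eqP <-; exists j.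
exists j.+1; first by rewrite mem_iota size_map add1n ltnS.
by rewrite (arc_length_labels famF) // jL.
Qed.

Lemma sum_window m (f : nat -> nat) v : (forall x, f (x + m) = f x) ->
  \sum_(v <= x < v + m) f x = \sum_(0 <= x < m) f x.
Proof.
move=> fper; elim: v => // v <-.
have [->|m_gt0] := posnP m; first by rewrite !addn0 !big_geq.
rewrite addSn big_nat_recr /=; last lia.
by rewrite (fper v) [RHS]big_ltn 1?addnC //; lia.
Qed.

Lemma sum_shift v a b (f : nat -> nat) :
  \sum_(v + a <= s < v + b) f s = \sum_(a <= s < b) f (v + s).
Proof.
rewrite [v + a]addnC big_addn (_ : v + b - v = b); last lia.
by apply: eq_bigr => s _; rewrite addnC.
Qed.

(** * The family of arcs of a periodic sequence of labels *)

Section Words.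
Variables (m : nat) (c : nat -> seq nat).
Hypothesis cper : forall v, c (v + m) = c v.
Hypothesis cpos : forall v, all (leq 1) (c v).
Hypothesis csum : \sum_(0 <= v < m) sumn (c v) < m.

Let len := arc_length m c.

Let sumn_take v j : sumn (take j (c v)) <= sumn (c v).
Proof. by rewrite -[X in _ <= sumn X](cat_take_drop j) sumn_cat leq_addr. Qed.

(** Over a full turn the labels add up to less than [m], so the first passage happens within one
    turn. *)
Let fits_m v j : fits c v j m.
Proof.
apply: leq_ltn_trans csum; rewrite -(@sum_window m (fun x => sumn (c x)) v) => [|x]; last by rewrite cper.
rewrite [X in _ <= X]big_ltn; last by have := leq_ltn_trans (leq0n _) csum; lia.
apply: leq_add; first exact: sumn_take.
by rewrite -[v.+1]addn1 sum_shift.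
Qed.

Lemma len_spec v j : [/\ len v j <= m, fits c v j (len v j)
  & forall x, x < len v j -> ~~ fits c v j x].
Proof.
have h : has (fits c v j) (iota 0 m.+1).
  by apply/hasP; exists m => //; rewrite mem_iota; lia.
have lm : len v j <= m by move: h; rewrite has_find size_iota.
split=> // [|x xl].
  by have := nth_find 0 h; rewrite nth_iota.
by have := before_find 0 xl; rewrite nth_iota ?add0n => [->|]; lia.
Qed.

(** A first passage is exact: the sum does not decrease with the length, is below [len v j] there,
    and was at least [len v j - 1] one step earlier. *)
Lemma len_eq v j :
  sumn (take j (c v)) + \sum_(1 <= s < len v j) sumn (c (v + s)) = (len v j).-1.
Proof.
have [lm fl minl] := len_spec v j; move: fl minl; rewrite /fits.
case: (len v j) => // l fl minl.
have := minl l (ltnSn l); rewrite /fits -leqNgt.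
suff : \sum_(1 <= s < l) sumn (c (v + s)) <= \sum_(1 <= s < l.+1) sumn (c (v + s)) by lia.
case: l {fl minl} => [|l]; first by rewrite !big_geq.
by rewrite [X in _ <= X]big_nat_recr //= leq_addr.
Qed.

Lemma sumn_takeS v j : j < size (c v) ->
  sumn (take j (c v)) < sumn (take j.+1 (c v)).
Proof.
move=> js; rewrite (take_nth 0 js) sumn_rcons.
by have /all_nthP/(_ j js) := cpos v; move/(_ 0); lia.
Qed.

(** Equal lengths would give both sides of [len_eq] the same value, although the two sums differ by
    a positive letter. *)
Lemma len_lt v j : j < size (c v) -> len v j < len v j.+1.
Proof.
move=> js; rewrite ltnNge; apply/negP => le_len.
have [_ fj _] := len_spec v j.+1.
have [_ _ minj] := len_spec v j.
have : fits c v j (len v j.+1).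
  by apply: leq_ltn_trans fj; rewrite leq_add2r ltnW // sumn_takeS.
have [e _|ne] := eqVneq (len v j.+1) (len v j); last by apply/negP/minj; lia.
by have := len_eq v j; have := len_eq v j.+1; rewrite e; have := sumn_takeS js; lia.
Qed.

Lemma len_gt1 v j : 0 < j <= size (c v) -> 1 < len v j.
Proof.
case: j => // j js; have := @len_lt v j js.
by have [_ + _] := len_spec v j; rewrite /fits; lia.
Qed.

Lemma arcs_ofP v L : reflect (exists2 j, j < size (c v) & len v j.+1 = L) (arcs_of m c v L).
Proof.
apply: (iffP hasP) => [[j]|[j js jL]].
  by rewrite mem_iota; case: j => // j js /eqP <-; exists j => //; lia.
by exists j.+1; [rewrite mem_iota; lia | rewrite -jL].
Qed.

(** For noncrossing, let [l] be the length of the outer arc. Since [t] does not fit, the labels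
    before [v + t] use up at least [t] of the total [l - 1]. The rest, with all labels at [v + t]
    included, is below [l - t], so every arc starting there has length at most [l - t]. *)
Lemma arcs_of_family : arc_family m (arcs_of m c).
Proof.
split=> [v L|v L|v L t L'].
- rewrite /arcs_of cper; apply: eq_has => j; congr (_ == _).
  rewrite /arc_length; apply: eq_find => x; rewrite /fits cper.
  by under eq_bigr => s _ do rewrite addnAC cper.
- case/arcs_ofP => j js <-; rewrite len_gt1 //.
  by case: (len_spec v j.+1).
case/arcs_ofP => j js <- t_int /arcs_ofP[k ks <-].
have [_ _ minl] := len_spec v j.+1.
have [_ _ minl'] := len_spec (v + t) k.+1.
suff : len (v + t) k.+1 <= len v j.+1 - t by lia.
rewrite leqNgt; apply/negP => /minl'/negP[]; rewrite /fits.
have := minl t; rewrite /fits -leqNgt => mt; have {}mt := mt (ltac:(lia)).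
move: (len_eq v j.+1) t_int; move: {minl minl'} (len v j.+1) => l + t_int.
rewrite (@big_cat_nat _ _ _ t) /=; [|lia..].
rewrite (@big_ltn _ _ _ t); last lia.
have -> : \sum_(t.+1 <= s < l) sumn (c (v + s)) =
          \sum_(1 <= s < l - t) sumn (c (v + t + s)).
  rewrite -[t.+1]addn1 -[l in LHS](subnKC (_ : t <= _)); last lia.
  by rewrite sum_shift; apply: eq_bigr => s _; rewrite addnA.
by have := sumn_take (v + t) k.+1; lia.
Qed.

Lemma arcs_at_arcs_of v :
  arcs_at m (arcs_of m c) v = [seq len v j | j <- iota 1 (size (c v))].
Proof.
apply: (irr_sorted_eq ltn_trans ltnn); first exact: arcs_at_sorted.
  rewrite sorted_map; apply/(sortedP 0) => i; rewrite size_iota => si /=.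
  rewrite !nth_iota ?add1n; [|lia..].
  by apply: len_lt; lia.
move=> L; rewrite (mem_arcs_at arcs_of_family); apply/arcs_ofP/mapP.
  by case=> j js <-; exists j.+1 => //; rewrite mem_iota; lia.
by case=> -[|j] //; rewrite mem_iota ?ltnn // => js ->; exists j => //; lia.
Qed.

Lemma size_labels_arcs_of v : size (labels_at m (arcs_of m c) v) = size (c v).
Proof. by rewrite size_map arcs_at_arcs_of size_map size_iota. Qed.

(** Induction on the length. The arcs starting strictly inside and the shorter arcs at [v] already
    have the right labels; [label_weight_eq] and [len_eq] give the same total, so the label of the
    arc itself agrees too. *)
Lemma labels_arcs_of v : labels_at m (arcs_of m c) v = c v.
Proof.
pose c' := labels_at m (arcs_of m c).
have famF := arcs_of_family.
suff main L : forall v j, j < size (c v) -> len v j.+1 = L -> nth 0 (c' v) j = nth 0 (c v) j.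
  apply: (@eq_from_nth _ 0); rewrite size_labels_arcs_of // => j js.
  exact: (main (len v j.+1)).
elim/ltn_ind: L => L IH {}v j js jL.
have sz' : size (c' v) = size (c v) by exact: size_labels_arcs_of.
have szF : size (arcs_at m (arcs_of m c) v) = size (c v).
  by rewrite arcs_at_arcs_of size_map size_iota.
have lenE u k : k < size (c u) -> nth 0 (arcs_at m (arcs_of m c) u) k = len u k.+1.
  move=> ku; rewrite arcs_at_arcs_of (nth_map 0) ?size_iota // nth_iota //.
have FvL : arcs_of m c v L by apply/arcs_ofP; exists j.
have := label_weight_eq famF FvL; have := len_eq v j.+1; rewrite jL => <-.
rewrite -jL -{1}lenE // label_weight_take ?szF // jL -/c'.
have -> : \sum_(1 <= s < L) sumn (c' (v + s)) = \sum_(1 <= s < L) sumn (c (v + s)).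
  rewrite big_nat [RHS]big_nat; apply: eq_bigr => s sL; congr sumn.
  apply: (@eq_from_nth _ 0); rewrite size_labels_arcs_of // => k ks.
  apply: (IH _ _ _ _ ks erefl); have [_ _ nc] := famF.
  have FL' : arcs_of m c (v + s) (len (v + s) k.+1) by apply/arcs_ofP; exists k.
  by have := nc _ _ _ _ FvL sL FL'; lia.
rewrite (take_nth 0 js) (take_nth 0 (_ : j < size (c' v))) ?sz' // !sumn_rcons.
suff -> : take j (c' v) = take j (c v) by lia.
apply: (@eq_from_nth _ 0); rewrite !size_takel ?sz' //; try lia.
move=> i ij; rewrite !nth_take //; apply: IH erefl; last lia.
have ijs : i < j -> j < size (c v) -> len v i.+1 < len v j.+1.
  rewrite -!lenE; [|lia..]; rewrite (sorted_ltn_nth ltn_trans) ?inE ?szF //; try lia.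
  exact: arcs_at_sorted.
by rewrite -jL ijs.
Qed.

End Words.

(** * Words and multinomial coefficients *)

(** Cuts a word at its separators [0]; the first component holds the letters in front of the first
    separator. *)
Fixpoint blocks_rec (w : seq nat) : seq nat * seq (seq nat) :=
  if w is a :: w' then
    let: (s, r) := blocks_rec w' in
    if a == 0 then ([::], s :: r) else (a :: s, r)
  else ([::], [::]).

Definition blocks w := (blocks_rec w).2.

Definition unblocks (r : seq (seq nat)) := flatten [seq 0 :: s | s <- r].

Lemma blocks_recK w : (blocks_rec w).1 ++ unblocks (blocks_rec w).2 = w.
Proof.
elim: w => //= a w; case: (blocks_rec w) => s r /= <-.
by case: eqP => [->|].
Qed.

Lemma flatten_blocks_rec w :
  (blocks_rec w).1 ++ flatten (blocks_rec w).2 = [seq a <- w | a != 0].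
Proof.
elim: w => //= a w; case: (blocks_rec w) => s r /= <-.
by case: eqP.
Qed.

Lemma size_blocks w : size (blocks w) = count_mem 0 w.
Proof.
rewrite /blocks; elim: w => //= a w; case: (blocks_rec w) => s r /= <-.
by case: eqP.
Qed.

Lemma unblocksK r : all (all (leq 1)) r -> blocks (unblocks r) = r.
Proof.
rewrite /blocks; elim: r => // s r IH /andP[s_pos /IH {IH}].
case E: (blocks_rec (unblocks r)) => [s1 r1] /= r1r.
have s10 : s1 = [::].
  by case: (r) E => [|s2 r2] /=; [case|case: (blocks_rec _) => ? ? []].
suff Es : blocks_rec (s ++ unblocks r) = (s, r1) by rewrite Es r1r.
elim: s s_pos => [|a s IHs] /=; first by rewrite E s10.
by case/andP => a_gt0 /IHs ->; case: a a_gt0.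
Qed.

Lemma perm_unblocks r : perm_eq (unblocks r) (nseq (size r) 0 ++ flatten r).
Proof.
elim: r => //= s r IH; rewrite -/(unblocks r) perm_cons perm_sym perm_catCA perm_cat2l.
by rewrite perm_sym.
Qed.

(** The multinomial coefficient, by induction on the first letter of the word. Letters of [T] absent
    from [s] contribute a factor 1. *)
Lemma size_permutations_count (s T : seq nat) : uniq T -> {subset s <= T} ->
  size (permutations s) * \prod_(x <- T) (count_mem x s)`! = (size s)`!.
Proof.
move=> uT; elim: {s}(size s) {-2}s (erefl (size s)) => [|n IH] s sz sT.
  by rewrite (size0nil sz) /= big1_eq.
rewrite (perm_size (permutationsE _)) ?sz // size_allpairs_dep sumnE big_map /=.
transitivity (\sum_(x <- undup s) count_mem x s * n`!).
  rewrite big_distrl /=; apply: eq_big_seq => x; rewrite mem_undup => xs.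
  have szr : size (rem x s) = n by rewrite size_rem // sz.
  rewrite -szr -(IH (rem x s) szr) => [|y /mem_rem /sT //].
  rewrite mulnCA; congr (_ * _).
  have xT := sT x xs.
  rewrite (bigD1_seq x) //= [in RHS](bigD1_seq x) //= mulnA; congr (_ * _).
    have : 0 < count_mem x s by rewrite -has_count has_pred1.
    by rewrite count_mem_rem eqxx; case: (count_mem x s) => // k _; rewrite subn1 factS.
  by apply: eq_bigr => y /negPf yx; rewrite count_mem_rem eq_sym yx subn0.
rewrite -big_distrl /= factS -sz; congr (_ * _).
rewrite -(perm_size (perm_count_undup s)) size_flatten sumnE /shape -map_comp big_map.
by apply: eq_bigr => x _; rewrite /= size_nseq.
Qed.

(** * Counting families of arcs *)

Lemma periodic_modn T m (f : nat -> T) v : (forall v, f (v + m) = f v) -> f (v %% m) = f v.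
Proof.
move=> fper; rewrite [in RHS](divn_eq v m) addnC.
by elim: (v %/ m) => [|k IH]; rewrite ?addn0 // mulSn addnCA addnC fper.
Qed.

Lemma periodic_eqmod T m (f : nat -> T) v w : (forall v, f (v + m) = f v) ->
  v = w %[mod m] -> f v = f w.
Proof. by move=> fper e; rewrite -(periodic_modn _ fper) e periodic_modn. Qed.

Section Families.
Variable m : nat.
Hypothesis m_gt0 : 0 < m.
Implicit Types (S : {set 'I_m * 'I_m.+1}) (F : nat -> nat -> bool).

(** To be counted, families are stored as finite sets of pairs of a start and a length; [arcs_fun]
    and [arcs_set] translate to periodic predicates and back. *)
Definition arcs_fun S v L := [exists p in S, (p.1 == v %% m :> nat) && (p.2 == L :> nat)].

Definition arcs_set F : {set 'I_m * 'I_m.+1} := [set p : 'I_m * 'I_m.+1 | F p.1 p.2].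

Definition all_labels F := flatten [seq labels_at m F v | v <- iota 0 m].

Definition families (nu : seq nat) : {set {set 'I_m * 'I_m.+1}} :=
  [set S | `[< arc_family m (arcs_fun S) >] & perm_eq (all_labels (arcs_fun S)) nu].

Lemma arcs_funE S (p : 'I_m * 'I_m.+1) : arcs_fun S p.1 p.2 = (p \in S).
Proof.
apply/existsP/idP => [[q /and3P[qS /eqP q1 /eqP q2]]|pS].
  rewrite modn_small // in q1; suff -> : p = q by [].
  by case: p q q1 q2 {qS} => [a b] [c d] /= /val_inj-> /val_inj->.
by exists p; rewrite pS modn_small // !eqxx.
Qed.

Lemma arcs_funK S : arcs_set (arcs_fun S) = S.
Proof. by apply/setP => p; rewrite inE arcs_funE. Qed.

Lemma arcs_setK F : arc_family m F -> arcs_fun (arcs_set F) = F.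
Proof.
move=> [Fper Flen _]; apply/funext => v; apply/funext => L; apply/existsP/idP.
  case=> p /and3P[]; rewrite inE => Fp /eqP p1 /eqP p2.
  by rewrite -(@periodic_modn _ m (F^~ L)) // -p1 -p2.
move=> FvL; have Lm : L < m.+1 by have := Flen _ _ FvL; lia.
have vm : v %% m < m by rewrite ltn_mod.
exists (Ordinal vm, Ordinal Lm); rewrite inE /= !eqxx !andbT.
by rewrite (@periodic_modn _ m (F^~ L)).
Qed.

Lemma mem_families F nu : arc_family m F ->
  (arcs_set F \in families nu) = perm_eq (all_labels F) nu.
Proof. by move=> famF; rewrite inE arcs_setK //; case: asboolP. Qed.

(** The dropped letter is the separator of the point [0], which always comes first; the remaining
    letters can be arranged freely. *)
Definition family_word S :=
  behead (unblocks [seq labels_at m (arcs_fun S) v | v <- iota 0 m]).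

Lemma all_labels_gt0 F v : arc_family m F -> all (leq 1) (labels_at m F v).
Proof.
move=> famF; apply/allP => x /mapP[L].
by rewrite (mem_arcs_at famF) => /(label_gt0 famF) label_gt0 ->.
Qed.

Lemma family_word_cons S : 0 :: family_word S = unblocks [seq labels_at m (arcs_fun S) v | v <- iota 0 m].
Proof. by rewrite /family_word; case: (m) m_gt0. Qed.

Lemma family_word_inj nu : {in families nu &, injective family_word}.
Proof.
move=> S1 S2; rewrite !inE => /andP[/asboolP fam1 _] /andP[/asboolP fam2 _] e.
have {e} e : [seq labels_at m (arcs_fun S1) v | v <- iota 0 m] =
         [seq labels_at m (arcs_fun S2) v | v <- iota 0 m].
  rewrite -[LHS]unblocksK -1?[RHS]unblocksK -?family_word_cons ?e //.
    by apply/allP => _ /mapP[v _ ->]; apply: all_labels_gt0.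
  by apply/allP => _ /mapP[v _ ->]; apply: all_labels_gt0.
have {e} e : labels_at m (arcs_fun S1) =1 labels_at m (arcs_fun S2).
  move=> v; rewrite -(periodic_modn _ (labels_at_per fam1)) -(periodic_modn _ (labels_at_per fam2)).
  have vm : v %% m < m by rewrite ltn_mod.
  have := congr1 (nth [::] ^~ (v %% m)) e.
  by rewrite !(nth_map 0) ?size_iota // !nth_iota.
rewrite -(arcs_funK S1) -(arcs_funK S2); congr arcs_set.
apply/funext => v; apply/funext => L.
by rewrite -(arcs_of_labels _ _ fam1) -(arcs_of_labels _ _ fam2) (funext e).
Qed.

Lemma nseq_predS : nseq m 0 = 0 :: nseq m.-1 0.
Proof. by case: (m) m_gt0. Qed.

(** Surjectivity is the point: cut at its separators and continued periodically, any arrangement is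
    the label sequence of [arcs_of], because the sum of its letters is below [m]. *)
Lemma card_families nu : all (leq 1) nu -> sumn nu < m ->
  #|families nu| = size (permutations (nseq m.-1 0 ++ nu)).
Proof.
move=> nu_pos nu_lt; rewrite -(size_image family_word); apply: perm_size.
apply: uniq_perm; [|exact: permutations_uniq|].
  rewrite map_inj_in_uniq ?enum_uniq // => S1 S2.
  by rewrite !mem_enum; exact: family_word_inj.
move=> u; rewrite mem_permutations; apply/imageP/idP.
  case=> S; rewrite inE => /andP[/asboolP fam lab_nu] ->.
  rewrite -(perm_cons 0) family_word_cons.
  apply: (perm_trans (perm_unblocks _)).
  by rewrite size_map size_iota nseq_predS /= perm_cons perm_cat2l.
move=> u_perm; pose r := blocks (0 :: u).
have ur : unblocks r = 0 :: u.
  have := blocks_recK (0 :: u); rewrite /r /blocks /=.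
  by case: (blocks_rec u).
have flat_r : perm_eq (flatten r) nu.
  have := flatten_blocks_rec (0 :: u); rewrite /r /blocks /=.
  case: (blocks_rec u) => s q /= ->.
  apply: (perm_trans (perm_filter _ u_perm)); rewrite filter_cat filter_nseq /=.
  by rewrite (all_filterP _) //; apply/allP => x /(allP nu_pos); case: x.
have size_r : size r = m.
  rewrite size_blocks -(prednK m_gt0) /= add1n; congr _.+1.
  rewrite (seq.permP u_perm) count_cat count_nseq mul1n.
  rewrite [X in _ + X](_ : _ = 0) ?addn0 //; apply/eqP; rewrite -leqn0 leqNgt -has_count has_pred1.
  by apply/negP => /(allP nu_pos).
pose c v := nth [::] r (v %% m).
have cper v : c (v + m) = c v by rewrite /c modnDr.
have cpos v : all (leq 1) (c v).
  apply/allP => x xc; apply: (allP nu_pos); rewrite -(perm_mem flat_r).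
  by apply/flattenP; exists (c v) => //; rewrite mem_nth // size_r ltn_mod.
have rE : r = [seq c v | v <- iota 0 m].
  apply: (@eq_from_nth _ [::]); rewrite ?size_map ?size_iota // => i im.
  rewrite (nth_map 0) ?size_iota -?size_r // nth_iota // add0n /c modn_small //.
  by rewrite -size_r.
have csum : \sum_(0 <= v < m) sumn (c v) < m.
  by rewrite -(perm_sumn flat_r) rE sumn_flatten -map_comp sumnE big_map /index_iota subn0 in nu_lt *.
have famF := arcs_of_family cper cpos csum.
have labE : labels_at m (arcs_of m c) = c.
  by apply/funext => v; apply: labels_arcs_of.
exists (arcs_set (arcs_of m c)).
  by rewrite mem_families // /all_labels labE -rE.
suff : 0 :: u = 0 :: family_word (arcs_set (arcs_of m c)) by case.
by rewrite family_word_cons arcs_setK // labE -rE ur.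
Qed.

(** The start is written [x + m - t], with [t < m], so that the subtraction never truncates. *)
Definition covered F x :=
  [exists t : 'I_m, exists L : 'I_m.+1, [&& 0 < t, t < L & F (x + m - t) L]].

Lemma sumn_all_labels F : sumn (all_labels F) = \sum_(0 <= v < m) sumn (labels_at m F v).
Proof. by rewrite sumn_flatten -map_comp sumnE big_map /index_iota subn0. Qed.

Section Covered.
Variable F : nat -> nat -> bool.
Hypothesis famF : arc_family m F.

Lemma coveredP x : reflect
  (exists v t L, [/\ F v L, 0 < t < L & v + t = x %[mod m]]) (covered F x).
Proof.
have [Fper Flen _] := famF.
apply: (iffP existsP) => [[t /existsP[L /and3P[t0 tL FL]]]|[v [t [L [FL tL vt]]]]].
  exists (x + m - t), t, L; rewrite t0 tL; split=> //.
  by rewrite subnK ?modnDr //; have := ltn_ord t; lia.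
have Lm := Flen _ _ FL.
have tm : t < m by lia.
have Lm1 : L < m.+1 by lia.
exists (Ordinal tm); apply/existsP; exists (Ordinal Lm1) => /=.
case/andP: tL => -> -> /=; rewrite -(@periodic_eqmod _ m (F^~ L) v) //.
apply/eqP; rewrite -(eqn_modDr t) vt subnK ?modnDr //; lia.
Qed.

(** The start of a longest arc works: an arc strictly around it would contain the longest arc and be
    longer. *)
Lemma uncovered_exists : exists z, ~~ covered F z.
Proof.
have [Fper Flen Fnc] := famF.
have [[v0 [L0 FL0]]|noF] := pselect (exists v L, F v L); last first.
  by exists 0; apply/coveredP => -[v [t [L [FL _ _]]]]; apply: noF; exists v, L.
pose P L := `[< exists v, F v L >].
have exP : exists L, P L by exists L0; apply/asboolP; exists v0.
have ubP L : P L -> L <= m by move/asboolP => [v /Flen/andP[]].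
case: (ex_maxnP exP ubP) => L /asboolP[v FvL] maxL.
exists v; apply/coveredP => -[u [t [L' [FL' tL' uv]]]].
have FvL' : F (u + t) L by rewrite (@periodic_eqmod _ m (F^~ L) (u + t) v).
have := Fnc _ _ _ _ FL' tL' FvL'.
by have : L' <= L; [apply: maxL; apply/asboolP; exists u | lia].
Qed.

(** Seen from an uncovered point [z] the circle is an interval, since no arc passes over [z]. Each
    point is then either uncovered or in exactly one label. *)
Lemma card_uncovered : \sum_(0 <= x < m) ~~ covered F x + sumn (all_labels F) = m.
Proof.
have [Fper Flen Fnc] := famF.
have [z unc_z] := uncovered_exists.
have covper x : covered F (x + m) = covered F x.
  by apply/coveredP/coveredP => -[v [t [L [? ? e]]]]; exists v, t, L; rewrite ?modnDr in e *.
have weight : sumn (all_labels F) = label_weight m F z m m.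
  rewrite sumn_all_labels -(@sum_window m _ z) => [|x]; last by rewrite (labels_at_per famF).
  rewrite big_ltn; last lia.
  rewrite sum_labels_at /label_weight; congr (_ + _).
  by rewrite -[z.+1]addn1 sum_shift.
have shifted : \sum_(0 <= t < m) ~~ covered F (z + t) = \sum_(0 <= t < m) ~~ covered F t.
  rewrite -[RHS](@sum_window m _ z) => [|t]; last by rewrite covper.
  by rewrite -{2}[z]addn0 sum_shift.
rewrite -shifted weight label_weight_card //.
rewrite [X in _ + X = _](@big_cat_nat _ _ _ m) /=; [|lia..].
rewrite [X in _ + (_ + X)]big_nat [X in _ + (_ + X)]big1 ?addn0; last first.
  move=> t /andP[mt _]; apply: eq_card0 => -[s L]; apply/negP; rewrite unfold_in.
  case/and4P => /= FL _ stL _; have := ltn_ord s => sm.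
  have := Flen _ _ FL => Lm.
  have /negP[] : ~~ covered F (z + m) by rewrite covper.
  by apply/coveredP; exists (z + s), (m - s), L; split=> //; [lia | congr (_ %% _); lia].
rewrite -big_split /= -[RHS]subn0 -[RHS]muln1 -sum_nat_const_nat.
rewrite big_nat [RHS]big_nat; apply: eq_bigr => t /andP[_ tm].
have [t0|t_gt0] := posnP t.
  rewrite t0 addn0 unc_z add1n; congr _.+1; apply: eq_card0 => -[s L]; apply/negP.
  by rewrite unfold_in => /and4P[].
have [/coveredP[v [t' [L [FL t'L e]]]]|unc_t] := boolP (covered F (z + t)).
  have Lm := Flen _ _ FL.
  rewrite add0n; apply/eqP; rewrite eqn_leq (inner_le1 famF) /=.
  have t't : t' <= t.
    rewrite leqNgt; apply/negP => tt'; move/coveredP: unc_z; apply.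
    exists v, (t' - t), L; split=> //; first lia.
    by apply/eqP; rewrite -(eqn_modDr t) -addnA subnK ?e // ltnW.
  have FzL : F (z + (t - t')) L.
    rewrite -(@periodic_eqmod _ m (F^~ L) v) //.
    by apply/eqP; rewrite -(eqn_modDr t') -addnA subnK // e.
  have tt : t - t' < t < t - t' + L by lia.
  have [s1 [L1 [st1 tL1 F1 le1 fr1]]] := innermost_exists famF FzL tt.
  have s1m : s1 < m by lia.
  have L1m : L1 < m.+1 by have := Flen _ _ F1; lia.
  apply/card_gt0P; exists (Ordinal s1m, Ordinal L1m); apply/and4P; split=> //=; last lia.
  by apply/implyP; lia.
rewrite add1n; congr _.+1; apply: eq_card0 => -[s L]; apply/negP.
rewrite unfold_in => /and4P[/= FL _ stL _]; move/coveredP: unc_t; apply.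
by exists (z + s), (t - s), L; split=> //; [lia | congr (_ %% _); lia].
Qed.

End Covered.

End Families.

(** * Rotating families of arcs, and families with a single uncovered point *)

Definition shift_arcs r (F : nat -> nat -> bool) v L := F (v + r) L.

Section Shift.
Variable m : nat.
Hypothesis m_gt0 : 0 < m.
Implicit Types F : nat -> nat -> bool.

Lemma periodicM T (f : nat -> T) k v : (forall v, f (v + m) = f v) -> f (v + k * m) = f v.
Proof. by move=> fper; apply: (periodic_eqmod fper); rewrite addnC modnMDl. Qed.

Lemma shift_family r F : arc_family m F -> arc_family m (shift_arcs r F).
Proof.
case=> Fper Flen Fnc; split=> [v L|v L|v L t L'] ; rewrite /shift_arcs.
- by rewrite addnAC Fper.
- exact: Flen.
by rewrite addnAC; exact: Fnc.
Qed.

Lemma shift_label r F v L : label (shift_arcs r F) v L = label F (v + r) L.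
Proof.
apply: eq_bigr => t _; congr nat_of_bool.
by apply: eq_forallb => s; apply: eq_forallb => L'; rewrite /shift_arcs addnAC.
Qed.

Lemma shift_labels_at r F v : labels_at m (shift_arcs r F) v = labels_at m F (v + r).
Proof. by apply: eq_map => L; rewrite shift_label. Qed.

Lemma perm_shift_labels r F : arc_family m F ->
  perm_eq (all_labels m (shift_arcs r F)) (all_labels m F).
Proof.
move=> famF; rewrite /all_labels (eq_map (shift_labels_at r F)).
elim: r => [|r IH]; first by under eq_map do rewrite addn0.
apply: perm_trans IH.
have -> : [seq labels_at m F (v + r.+1) | v <- iota 0 m] = [seq labels_at m F (v + r) | v <- iota 1 m].
  by rewrite -[1]addn0 iotaDl -map_comp; apply: eq_map => v /=; rewrite addnS.
have -> : iota 0 m = 0 :: iota 1 m.-1 by case: (m) m_gt0.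
have -> : iota 1 m = iota 1 m.-1 ++ [:: m].
  by rewrite -{1}(prednK m_gt0) -[X in iota 1 X]addn1 iotaD add1n prednK.
rewrite map_cat flatten_cat /= cats0 perm_catC addnC.
by rewrite (labels_at_per famF).
Qed.

Lemma shift_covered r F x : arc_family m F -> covered m (shift_arcs r F) x = covered m F (x + r).
Proof.
move=> famF; have famF' := shift_family r famF.
apply/(coveredP m_gt0 famF')/(coveredP m_gt0 famF) => -[v [t [L [FL tL e]]]].
  exists (v + r), t, L; split=> //.
  by apply/eqP; rewrite addnAC eqn_modDr e.
(* Modulo [m], going back by [r] is going forward by [r * m.-1]. *)
have rm : r * m = r * m.-1 + r by rewrite -{1}(prednK m_gt0) mulnS addnC.
exists (v + r * m.-1), t, L; split=> //.
  rewrite /shift_arcs -addnA -rm.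
  by have [Fper _ _] := famF; rewrite (@periodicM _ (F^~ L)).
apply/eqP; rewrite -(eqn_modDr r).
have -> : v + r * m.-1 + t + r = r * m + (v + t) by lia.
by rewrite modnMDl e.
Qed.

Lemma shift_arcs_inj r F F' : arc_family m F -> arc_family m F' ->
  shift_arcs r F = shift_arcs r F' -> F = F'.
Proof.
move=> [Fper _ _] [Fper' _ _] e; apply/funext => v; apply/funext => L.
rewrite -(@periodicM _ (F^~ L) r v) // -(@periodicM _ (F'^~ L) r v) //.
rewrite -(prednK m_gt0) mulnS [r + _]addnC addnA.
exact: (congr1 (fun G => G (v + r * m.-1) L) e).
Qed.

Definition families_around z nu := [set S in families m nu | ~~ covered m (arcs_fun S) z].

(** Rotation by [z - w] is an injection. The lemma is used in both directions to get equality. *)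
Lemma card_families_around_le nu z w : z < m -> w < m ->
  #|families_around z nu| <= #|families_around w nu|.
Proof.
move=> zm wm; pose r := z + m - w.
pose f (S : {set 'I_m * 'I_m.+1}) := arcs_set m (shift_arcs r (arcs_fun S)).
have famP S : S \in families_around z nu -> arc_family m (arcs_fun S).
  by rewrite !inE => /andP[/andP[/asboolP]].
have f_inj : {in families_around z nu &, injective f}.
  move=> S1 S2 /famP fam1 /famP fam2 /(congr1 (@arcs_fun m)).
  rewrite !arcs_setK //; try exact: shift_family.
  by move/shift_arcs_inj => e; rewrite -(arcs_funK S1) -(arcs_funK S2) e.
rewrite -(card_in_imset f_inj); apply/subset_leq_card/subsetP => _ /imsetP[S Sz ->].
have fam := famP S Sz; move: Sz; rewrite !inE => /andP[/andP[_ lab_nu] unc].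
rewrite arcs_setK //; last exact: shift_family.
rewrite asboolT; last exact: shift_family.
rewrite (perm_trans (perm_shift_labels r fam)) //= shift_covered //.
have -> : w + r = z + m by rewrite /r; lia.
suff -> : covered m (arcs_fun S) (z + m) = covered m (arcs_fun S) z by [].
by apply/(coveredP m_gt0 fam)/(coveredP m_gt0 fam) => -[v [t [L [? ? e]]]]; exists v, t, L;
  rewrite ?modnDr in e *.
Qed.

(** With label sum [m - 1], [card_uncovered] leaves exactly one uncovered point, and its position
    splits the families into [m] classes of equal size. *)
Lemma card_families_around nu : sumn nu = m.-1 ->
  #|families m nu| = m * #|families_around 0 nu|.
Proof.
move=> nu_sum; transitivity (\sum_(0 <= z < m) #|families_around z nu|).
  rewrite -sum1_card.
  transitivity (\sum_(S in families m nu) \sum_(0 <= z < m) ~~ covered m (arcs_fun S) z).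
    apply: eq_bigr => S; rewrite inE => /andP[/asboolP fam /perm_sumn lab_nu].
    by have := card_uncovered m_gt0 fam; rewrite lab_nu nu_sum; lia.
  rewrite exchange_big; apply: eq_bigr => z _ /=.
  rewrite -sum1_card [RHS]big_mkcond [LHS]big_mkcond; apply: eq_bigr => S _.
  have -> : (S \in families_around z nu) = (S \in families m nu) && ~~ covered m (arcs_fun S) z.
    by rewrite in_set.
  by case: (S \in _); case: (covered _ _ _).
rewrite -[X in X * _]subn0 -sum_nat_const_nat big_nat [RHS]big_nat; apply: eq_bigr => z zm.
by apply/eqP; rewrite eqn_leq !card_families_around_le.
Qed.

Lemma uncovered0_arc F v L : arc_family m F -> ~~ covered m F 0 -> v < m -> F v L -> v + L <= m.
Proof.
move=> famF unc vm FvL; have [_ Flen _] := famF; have Lm := Flen _ _ FvL.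
rewrite leqNgt; apply/negP => vL; move/(coveredP m_gt0 famF): unc; apply.
exists v, (m - v), L; split=> //.
  by case: v vm FvL vL => [|v] vm FvL vL; lia.
by rewrite subnKC ?modnn ?mod0n // ltnW.
Qed.

(** Take the longest arc at [0]. If it ended at some [L < m], the arc covering [L] would start at
    [0], against maximality, or strictly inside, against noncrossing. *)
Lemma uncovered0_loop F : arc_family m F -> 1 < m -> ~~ covered m F 0 ->
  (forall x, 0 < x < m -> covered m F x) -> F 0 m.
Proof.
move=> famF m_gt1 unc0 cov; have [Fper Flen Fnc] := famF.
have arcle v L : v < m -> F v L -> v + L <= m by exact: uncovered0_arc.
have cov' x : 0 < x < m -> exists v t L, [/\ F v L, v < m, 0 < t < L & v + t = x].
  move=> xm; have /(coveredP m_gt0 famF)[v [t [L [FL tL e]]]] := cov x xm.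
  have vm : v %% m < m by rewrite ltn_mod.
  have FvL : F (v %% m) L by rewrite (@periodic_modn _ m (F^~ L)).
  exists (v %% m), t, L; split=> //.
  have vt : v %% m + t < m by have := arcle _ _ vm FvL; lia.
  have xm' : x < m by case/andP: xm.
  by move: e; rewrite -modnDml (modn_small vt) (modn_small xm').
have ubP L : F 0 L -> L <= m by move/Flen; lia.
have exP : exists L, F 0 L.
  have [v [t [L [FL _ tL vt]]]] := cov' 1 m_gt1.
  by exists L; have -> : 0 = v by lia.
case: (ex_maxnP exP ubP) => L FL maxL.
have [->//|Lm] : m = L \/ L < m by have := ubP L FL; lia.
have L_int : 0 < L < m by have := Flen _ _ FL; lia.
have [v [t [L' [FL' vm tL' vt]]]] := cov' L L_int.
have [v0|v_gt0] := posnP v; first by have := maxL L' ; rewrite -v0 FL'; lia.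
have vL : 0 < v < L by lia.
by have := Fnc 0 L v L' FL vL FL'; lia.
Qed.

End Shift.

(** * Chords of the regular polygon *)

Lemma nat_gap (P : pred nat) a y c : P a -> P c -> a < y < c -> ~~ P y ->
  exists a' b', [/\ a <= a' < y, y < b' <= c, P a', P b' & forall x, a' < x < b' -> ~~ P x].
Proof.
move=> Pa Pc y_int nPy.
pose Q x := (x < y) && P x.
have exQ : exists x, Q x by exists a; rewrite /Q Pa andbT; case/andP: y_int.
have ubQ x : Q x -> x <= y by case/andP => /ltnW.
case: (ex_maxnP exQ ubQ) => a' /andP[a'y Pa'] maxa'.
pose Q' x := (y < x) && P x.
have exQ' : exists x, Q' x by exists c; rewrite /Q' Pc andbT; case/andP: y_int.
case: (ex_minnP exQ') => b' /andP[yb' Pb'] minb'.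
exists a', b'; split=> //.
- by rewrite a'y andbT maxa' // /Q Pa andbT; case/andP: y_int.
- by rewrite yb' /= minb' // /Q' Pc andbT; case/andP: y_int.
move=> x xab; apply/negP => Px.
have [xy|yx|xy] := ltngtP x y; last by move: nPy; rewrite -xy Px.
  by have := maxa' x; rewrite /Q xy Px => /(_ isT); lia.
by have := minb' x; rewrite /Q' yx Px => /(_ isT); lia.
Qed.

Definition uncovered_by (G : nat -> nat -> bool) x :=
  forall s L, G s L -> s < x -> s + L <= x.

(** If [a + 1] is covered, the covering arc starts at [a]. The end of the longest arc at [a] is
    uncovered, so it must be [b]. Stated for arcs on the line, it serves both for the arcs inside a
    given arc and for all arcs. *)
Lemma consecutive_arc (G : nat -> nat -> bool) M a b :
  (forall s L, G s L -> L <= M) ->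
  (forall s L t L', G s L -> 0 < t < L -> G (s + t) L' -> t + L' <= L) ->
  a < b -> uncovered_by G a -> uncovered_by G b ->
  (forall x, a < x < b -> ~ uncovered_by G x) -> b = a.+1 \/ G a (b - a).
Proof.
move=> Gle Gnc ab ua ub nu.
have [->|b_a1] := eqVneq b a.+1; [by left | right].
have [L0 GL0 L0_gt1] : exists2 L, G a L & 1 < L.
  apply: contrapT => noL; apply: (nu a.+1); first lia.
  move=> s L GL sa; have [sa'|s_a] := ltnP s a; first by have := ua _ _ GL sa'; lia.
  have sE : s = a by lia.
  rewrite sE in GL *; rewrite leqNgt; apply/negP => L_gt1; apply: noL; exists L => //; lia.
have exG : exists L, G a L by exists L0.
case: (ex_maxnP exG (Gle a)) => L GL Lmax.
have L0L := Lmax _ GL0.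
have uL : uncovered_by G (a + L).
  move=> s L2 GL2 saL; have [sa|as_|sE] := ltngtP s a.
  - by have := ua _ _ GL2 sa; lia.
  - have := Gnc a L (s - a) L2 GL; rewrite subnKC; last exact: ltnW.
    by move=> /(_ _ GL2); lia.
  by rewrite sE in GL2 *; have := Lmax _ GL2; lia.
have bL : ~ (a + L < b) by move=> aLb; apply: (nu _ _ uL); lia.
have := ub a L GL ab => Lb.
by have -> : b - a = L by lia.
Qed.

Section Vertices.
Variable n : nat.
Local Notation N := n.+2.
Implicit Types (A : {set 'I_N}) (e f : {set 'I_N}).

(** Vertices are handled through representatives in [nat]: cyclic order becomes ordinary
    inequalities in a window of length [N]. *)
Definition pt (x : nat) : 'I_N := inZp x.

Lemma pt_val (x : 'I_N) : pt x = x.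
Proof. exact: valZpK. Qed.

Lemma pt_eq x y : (pt x == pt y) = (x == y %[mod N]).
Proof. by rewrite -val_eqE. Qed.

Lemma ptD x : pt (x + N) = pt x.
Proof. by apply/eqP; rewrite pt_eq modnDr. Qed.

Lemma ptMD x k : pt (x + k * N) = pt x.
Proof. by apply/eqP; rewrite pt_eq addnC modnMDl. Qed.

Lemma pt_sub x t : (pt (x + t) - pt x)%R = pt t.
Proof.
apply/eqP; rewrite subr_eq addrC; apply/eqP/val_inj => /=.
by rewrite modnDml modnDmr.
Qed.

Lemma val_pt_sub x t : t < N -> val (pt (x + t) - pt x)%R = t.
Proof. by move=> tN; rewrite pt_sub /= modn_small. Qed.

Lemma pt_offset a (x : 'I_N) : exists2 t, t < N & x = pt (a + t).
Proof.
exists (val (x - pt a)%R); first exact: ltn_ord.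
transitivity (pt a + (x - pt a))%R; first by rewrite addrC subrK.
by apply/val_inj; rewrite [LHS]/= modnDml.
Qed.

Lemma pt_inj_window a x y : a <= x < a + N -> a <= y < a + N -> pt x = pt y -> x = y.
Proof.
move=> xa ya /(congr1 (fun z => val (z - pt a)%R)).
have -> : x = a + (x - a) by lia.
have -> : y = a + (y - a) by lia.
by rewrite !val_pt_sub; lia.
Qed.

Lemma between_pt a s t : s < N -> t < N -> between (pt a) (pt (a + s)) (pt (a + t)) = (0 < s < t).
Proof. by move=> sN tN; rewrite /between !val_pt_sub. Qed.

Lemma chord_cases a b c d : [set pt a; pt b] = [set pt c; pt d] ->
  (pt a = pt c /\ pt b = pt d) \/ (pt a = pt d /\ pt b = pt c).
Proof.
move=> e.
have : pt a \in [set pt c; pt d] by rewrite -e set21.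
have : pt b \in [set pt c; pt d] by rewrite -e set22.
have : pt c \in [set pt a; pt b] by rewrite e set21.
have : pt d \in [set pt a; pt b] by rewrite e set22.
rewrite !inE => /orP[]/eqP d1 /orP[]/eqP c1 /orP[]/eqP b1 /orP[]/eqP a1; rewrite ?a1 ?b1 ?c1 ?d1; auto.
all: try (left; split; congruence).
all: try (right; split; congruence).
Qed.

Definition consecutive A a b := [/\ a < b < a + N, pt a \in A, pt b \in A
  & forall x, a < x < b -> pt x \notin A].

Lemma sidesP A e : reflect (exists a b, consecutive A a b /\ e = [set pt a; pt b]) (e \in sides A).
Proof.
apply: (iffP imset2P) => [[a b aA]|[a [b [[ab aA bA no] ->]]]].
  rewrite inE => /and3P[bA ab /forallP no] ->.
  have [t tN bE] := pt_offset a b; rewrite bE; exists a, (a + t); rewrite pt_val; split=> //.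
  split; rewrite ?pt_val -?bE //.
    by case: t bE tN => [|t] bE tN; [move: ab; rewrite bE addn0 pt_val eqxx | lia].
  move=> x xat; apply/negP => xA; have /implyP/(_ xA)/negP[] := no (pt x).
  have -> : x = a + (x - a) by lia.
  by rewrite bE -{1}[a]pt_val between_pt; lia.
exists (pt a) (pt b) => //; rewrite inE; apply/and3P; split=> //.
  by apply/eqP => /(@pt_inj_window a); lia.
apply/forallP => x; apply/implyP => xA; apply/negP.
have [t tN xE] := pt_offset a x; rewrite xE in xA *.
have -> : b = a + (b - a) by lia.
rewrite between_pt; [|lia..] => tb.
by have := no (a + t); rewrite xA; lia.
Qed.

Lemma side_setT a b : a < b < a + N -> [set pt a; pt b] \in sides setT -> b = a.+1 \/ b.+1 = a + N.
Proof.
move=> ab /sidesP[c [d [[cd _ _ no]]]].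
have dE : d = c.+1.
  apply/eqP; rewrite eqn_leq andbC; apply/andP; split; first lia.
  by rewrite leqNgt; apply/negP => cd'; have := no c.+1; rewrite inE; lia.
rewrite {}dE in no cd *; case/chord_cases => -[e1 e2]; [left|right].
  have : pt b = pt a.+1.
    by apply/eqP; rewrite e2 pt_eq -[c.+1]addn1 -[a.+1]addn1 eqn_modDr -pt_eq e1.
  by move/(@pt_inj_window a); lia.
have : pt b.+1 = pt (a + N).
  by apply/eqP; rewrite ptD e1 pt_eq -[c.+1]addn1 -[b.+1]addn1 eqn_modDr -pt_eq e2.
by move/(@pt_inj_window a.+1); lia.
Qed.

(** If one of the two arcs cut out by the chord had no further point of [A], the chord read in that
    direction would be a side. *)
Lemma diagonalsP A e : reflect (exists a x b y, [/\ a < x < b, b < y < a + N,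
    [/\ pt a \in A, pt x \in A, pt b \in A & pt y \in A] & e = [set pt a; pt b]])
  (e \in diagonals A).
Proof.
apply: (iffP setDP) => [[]|[a [x [b [y [xab yab [aA xA bA yA] ->]]]]]].
  rewrite inE => /andP[eA /cards2P[a [b [ab eE]]]]; rewrite eE in eA *.
  have [a0 a0E] : exists a0, a = pt a0 by exists a; rewrite pt_val.
  move: a a0 a0E eA ab {eE} => _ a -> eA ab.
  have aA : pt a \in A by apply: (subsetP eA); rewrite set21.
  have bA : b \in A by apply: (subsetP eA); rewrite set22.
  have [t tN bE] := pt_offset a b; rewrite {}bE in eA ab bA *.
  have t0 : 0 < t by case: t {tN eA bA} ab => //; rewrite addn0 eqxx.
  move=> ns.
  have [x xat xA] : exists2 x, a < x < a + t & pt x \in A.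
    apply: contrapT => nx; case/negP: ns; apply/sidesP; exists a, (a + t); split=> //.
    by split=> //; [lia | move=> x xat; apply/negP => xA; apply: nx; exists x].
  have [y yat yA] : exists2 y, a + t < y < a + N & pt y \in A.
    apply: contrapT => ny; case/negP: ns; apply/sidesP; exists (a + t), (a + N).
    rewrite ptD; split; last by rewrite setUC.
    by split; rewrite ?ptD //; [lia | move=> y yat; apply/negP => yA; apply: ny; exists y].
  by exists a, x, (a + t), y.
have ab : pt a != pt b by apply/eqP => /(@pt_inj_window a); lia.
split.
  by rewrite inE cards2 ab eqxx andbT; apply/subsetP => z; rewrite !inE => /orP[]/eqP->.
apply/negP => /sidesP[c [d [[cd _ _ no] /esym]]].
have aux a' b' x' : a' < x' < b' -> b' < a' + N -> pt x' \in A -> pt c = pt a' -> pt d = pt b' -> False.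
  move=> xab' b'N x'A ca db.
  have dc : d - c = b' - a'.
    have := congr1 (fun z => val (z - pt c)%R) db; rewrite {2}ca.
    have -> : d = c + (d - c) by lia.
    have -> : b' = a' + (b' - a') by lia.
    by rewrite !val_pt_sub; lia.
  have := no (c + (x' - a')).
  have -> : pt (c + (x' - a')) = pt x'.
    apply/eqP; rewrite pt_eq -{2}(subnKC (_ : a' <= x')); last lia.
    by rewrite eqn_modDr -pt_eq ca.
  by rewrite x'A; lia.
case/chord_cases => -[ca db]; first by apply: (aux a b x) => //; lia.
by apply: (aux b (a + N) y); rewrite ?ptD //; lia.
Qed.

Lemma crossingP e f : reflect
  (exists a c b d, [/\ a < c < b, b < d < a + N, e = [set pt a; pt b] & f = [set pt c; pt d]])
  (crossing e f).
Proof.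
apply: (iffP existsP) => [[a /existsP[b /existsP[c /existsP[d]]]]|[a [c [b [d [acb bda -> ->]]]]]].
  case/and4P => /eqP-> /eqP-> acb bda.
  have [t tN bE] := pt_offset a b; have [s sN cE] := pt_offset a c.
  have [u uN dE] := pt_offset b d.
  rewrite -(pt_val a) bE cE between_pt // in acb.
  have aE : pt a = pt (b + (N - t)).
    by apply/eqP; rewrite pt_val -val_eqE [in X in _ == X]/= bE /=
      modnDml -addnA subnKC ?modnDr ?modn_small // ltnW.
  rewrite -[X in between _ _ X]pt_val aE dE -{1}(pt_val b) between_pt in bda; [|lia..].
  exists a, (a + s), (a + t), (a + t + u); rewrite -bE -cE pt_val; split=> //; try lia.
  congr [set _; _]; rewrite dE; apply/eqP; rewrite pt_eq eqn_modDr.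
  by rewrite -pt_eq -bE pt_val.
exists (pt a); apply/existsP; exists (pt b); apply/existsP; exists (pt c); apply/existsP; exists (pt d).
rewrite !eqxx /=; have -> : c = a + (c - a) by lia.
have {1}-> : b = a + (b - a) by lia.
rewrite between_pt; [|lia..].
have -> : pt a = pt (b + (a + N - b)) by rewrite subnKC ?ptD //; lia.
have -> : d = b + (d - b) by lia.
by rewrite between_pt; lia.
Qed.

End Vertices.

(** * Pieces of the dissection given by a family of arcs *)

Section Pieces.
Variable n : nat.
Local Notation N := n.+2.
Local Notation pt := (@pt n).
Variable F : nat -> nat -> bool.
Hypothesis famF : arc_family N F.
Hypothesis F_lt : forall v L, F v L -> L < N.
Implicit Type A : {set 'I_N}.

Let Fper v L : F (v + N) L = F v L. Proof. by case: famF. Qed.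
Let Flen v L : F v L -> 1 < L. Proof. by case: famF => _ + _ => /[apply] /andP[]. Qed.
Let Fnc v L t L' : F v L -> 0 < t < L -> F (v + t) L' -> t + L' <= L.
Proof. by case: famF => _ _; apply. Qed.

Lemma F_pt a b L : pt a = pt b -> F a L = F b L.
Proof. by move=> /eqP; rewrite pt_eq => /eqP e; apply: (@periodic_eqmod _ N (F^~ L)). Qed.

Lemma nested_arc v w L L' : F v L -> v < w < v + L -> F w L' -> w + L' <= v + L.
Proof.
move=> FL vw FL'; have tL : 0 < w - v < L by lia.
have FL2 : F (v + (w - v)) L' by rewrite subnKC //; lia.
by have := Fnc FL tL FL2; lia.
Qed.

(** An arc of length [N - 1] joins neighbouring vertices and yields no diagonal. Such an arc does
    occur: the root side, when all dissections are counted. *)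
Definition chords_of : {set {set 'I_N}} :=
  [set e in diagonals setT | `[< exists v L, F v L /\ e = [set pt v; pt (v + L)] >]].

Lemma chords_ofP a b : a < b < a + N -> [set pt a; pt b] \in chords_of ->
  F a (b - a) \/ F b (a + N - b).
Proof.
move=> ab; rewrite inE => /andP[_ /asboolP[v [L [FL]]]].
have L_lt := F_lt FL.
case/chord_cases => -[av bv]; [left|right].
  rewrite (F_pt _ av); suff -> : b - a = L by [].
  have : pt b = pt (a + L).
    by rewrite bv; apply/eqP; rewrite pt_eq eqn_modDr -pt_eq av.
  by move/(@pt_inj_window _ a); lia.
rewrite (F_pt _ bv); suff -> : a + N - b = L by [].
have : pt (a + N) = pt (b + L).
  by rewrite ptD av; apply/eqP; rewrite pt_eq eqn_modDr -pt_eq bv.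
by move/(@pt_inj_window _ b); lia.
Qed.

Lemma mem_chords_of v L : F v L -> L.+1 < N -> [set pt v; pt (v + L)] \in chords_of.
Proof.
move=> FL LN; have L1 := Flen FL; rewrite inE; apply/andP; split.
  by apply/diagonalsP; exists v, v.+1, (v + L), (v + L).+1; split=> //; [lia | lia | split; rewrite in_setT].
by apply/asboolP; exists v, L.
Qed.

Lemma chords_of_sides v L : F v L -> [set pt v; pt (v + L)] \in sides setT :|: chords_of.
Proof.
move=> FL; rewrite in_setU; have [LN|LN] := ltnP L.+1 N; first by rewrite mem_chords_of ?orbT.
apply/orP; left; apply/sidesP; exists (v + L), (v + N); split; last by rewrite ptD setUC.
by have := F_lt FL; split; rewrite ?inE //; [lia|move=> x; lia].
Qed.

Lemma side_edge a : [set pt a; pt a.+1] \in sides setT.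
Proof.
by apply/sidesP; exists a, a.+1; split=> //; split; rewrite ?inE //; [lia|move=> x; lia].
Qed.

Lemma chords_of_noncrossing a c b d : a < c < b -> b < d < a + N ->
  [set pt a; pt b] \in chords_of -> [set pt c; pt d] \in chords_of -> False.
Proof.
move=> acb bda /chords_ofP ab /chords_ofP cd.
have {}ab : F a (b - a) \/ F b (a + N - b) by apply: ab; lia.
have {}cd : F c (d - c) \/ F d (c + N - d) by apply: cd; lia.
have nc := nested_arc.
case: ab => Fab; case: cd => Fcd.
- by have := nc _ _ _ _ Fab _ Fcd; lia.
- by have := nc _ (a + N) _ (b - a) Fcd _; rewrite Fper Fab; lia.
- by have := nc _ _ _ _ Fcd _ Fab; lia.
by have := nc _ _ _ _ Fab _ Fcd; lia.
Qed.

Lemma dissection_chords_of : dissection chords_of.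
Proof.
apply/andP; split; first by apply/subsetP => e; rewrite inE => /andP[].
apply/forallP => e; apply/implyP => eD; apply/forallP => f; apply/implyP => fD.
apply/negP => /crossingP[a [c [b [d [acb bda eE fE]]]]].
by apply: (@chords_of_noncrossing a c b d) => //; rewrite -?eE -?fE.
Qed.

Definition is_cell (A : {set 'I_N}) :=
  (forall a b, consecutive A a b -> [set pt a; pt b] \in sides setT :|: chords_of) /\
  (forall a x b y, a < x < b -> b < y < a + N -> pt a \in A -> pt x \in A -> pt b \in A ->
     pt y \in A -> [set pt a; pt b] \notin chords_of).

Lemma piecesP A : reflect (2 < #|A| /\ is_cell A) (A \in pieces chords_of).
Proof.
rewrite inE; apply: (iffP and3P) => [[A2 /subsetP sA dA]|[A2 [sA dA]]]; split=> //.
- split=> [a b ab|a x b y axb bya aA xA bA yA]; first by apply/sA/sidesP; exists a, b.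
  apply/negP => abD; have /pred0P/(_ [set pt a; pt b]) := dA.
  rewrite /= abD andbT => /negP[]; apply/diagonalsP; exists a, x, b, y; split=> //.
- by apply/subsetP => _ /sidesP[a [b [ab ->]]]; apply: sA.
apply/pred0P => e /=; apply/negP => /andP[/diagonalsP[a [x [b [y [axb bya [aA xA bA yA] ->]]]]]].
by apply/negP; apply: (dA a x b y).
Qed.

Lemma third_point A a : 2 < #|A| -> pt a \in A ->
  exists y1 y2, [/\ a < y1, y1 < y2, y2 < a + N, pt y1 \in A & pt y2 \in A].
Proof.
move=> A2 aA; have : 1 < #|A :\ pt a| by rewrite (cardsD1 (pt a) A) aA in A2.
case/card_gt1P => y [z [/setD1P[ya yA] /setD1P[za zA] yz]].
have [s sN yE] := pt_offset a y; have [t tN zE] := pt_offset a z.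
rewrite {}yE in ya yA yz *; rewrite {}zE in za zA yz *.
have s0 : 0 < s by case: s {yA yz sN} ya => //; rewrite addn0 eqxx.
have t0 : 0 < t by case: t {zA yz tN} za => //; rewrite addn0 eqxx.
have [st|ts|st] := ltngtP s t; last by rewrite st eqxx in yz.
  by exists (a + s), (a + t); split=> //; lia.
by exists (a + t), (a + s); split=> //; lia.
Qed.

Lemma consecutive_lt A a b : 2 < #|A| -> consecutive A a b -> b.+1 < a + N.
Proof.
move=> A2 [ab aA bA no]; have [y1 [y2 [ay1 y12 y2a y1A y2A]]] := third_point A2 aA.
by have := no y1; rewrite y1A; lia.
Qed.

Lemma consecutive_cell A a b : 2 < #|A| -> is_cell A -> consecutive A a b ->
  [\/ b = a.+1, F a (b - a) | F b (a + N - b)].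
Proof.
move=> A2 [sA _] ab; have b_lt := consecutive_lt A2 ab; have := sA _ _ ab.
have [ab' _ _ _] := ab.
rewrite in_setU => /orP[/side_setT|/chords_ofP]; case=> //; auto; try lia.
all: by [constructor 1 | constructor 2 | constructor 3].
Qed.

Lemma gap_consecutive A a y c : 2 < #|A| -> pt a \in A -> pt c \in A -> a < y < c ->
  pt y \notin A -> exists a' b', [/\ a <= a' < y, y < b' <= c & consecutive A a' b'].
Proof.
move=> A2 aA cA ay yA; have [a' [b' [a'y yb' a'A b'A no]]] :=
  @nat_gap (fun x => pt x \in A) a y c aA cA ay yA.
exists a', b'; split=> //; split=> //.
have [y1 [y2 [ay1 y12 y2a y1A _]]] := third_point A2 a'A.
by have := no y1; rewrite y1A; lia.
Qed.

(** Offsets of the vertices of the piece just inside an arc: its two ends and the points of its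
    label. *)
Definition cellp v L t := [|| t == 0, t == L | innermost_at F v L t].

Definition cell v L : {set 'I_N} :=
  [set x | (val (x - pt v)%R <= L) && cellp v L (val (x - pt v)%R)].

Lemma mem_cell v L t : t < N -> (pt (v + t) \in cell v L) = (t <= L) && cellp v L t.
Proof. by move=> tN; rewrite inE val_pt_sub. Qed.

Lemma innermost_atFP v L t : F v L -> t < L ->
  reflect (forall s L', s < t -> t < s + L' -> F (v + s) L' -> s = 0 /\ L <= L')
          (innermost_at F v L t).
Proof. by move=> FL tL; apply: (innermost_atP famF). Qed.

Lemma card_cell v L : F v L -> #|cell v L| = (label F v L).+2.
Proof.
move=> FL; have L1 := Flen FL; have LN := F_lt FL.
have -> : #|cell v L| = \sum_(0 <= t < N) ((t <= L) && cellp v L t).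
  rewrite -sum1_card big_mkcond /= (reindex (fun t : 'I_N => pt (v + t))) /=; last first.
    exists (fun x : 'I_N => (x - pt v)%R) => x _.
      by apply/val_inj; rewrite /= -[RHS](val_pt_sub v (ltn_ord x)).
    by have [t tN ->] := pt_offset v x; rewrite val_pt_sub.
  by rewrite big_mkord; apply: eq_bigr => t _; rewrite mem_cell //; case: (_ && _).
rewrite (@big_cat_nat _ _ _ L.+1) /=; [|lia..].
rewrite [X in _ + X]big_nat [X in _ + X]big1 ?addn0; last by move=> t; case: leqP => //; lia.
rewrite big_nat_recr //= leqnn /cellp eqxx orbT big_ltn /=; last lia.
rewrite add1n addn1; congr _.+2; rewrite /label big_nat [RHS]big_nat; apply: eq_bigr => t tL.
have -> : (t <= L) = true by lia.
have -> : (t == 0) = false by lia.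
by have -> : (t == L) = false by lia.
Qed.

(* [proper v L] are the arcs inside the arc [(v, L)], by their offset from [v]. *)
Definition proper v L s L' := [&& F (v + s) L', s + L' <= L & (0 < s) || (L' < L)].

(** This form lets [consecutive_arc] find the sides of a cell among the arcs [proper v L]. *)
Lemma cellpP v L t : F v L -> t <= L -> reflect (uncovered_by (proper v L) t) (cellp v L t).
Proof.
move=> FL tL; have L1 := Flen FL; apply: (iffP or3P) => [[/eqP->|/eqP->|fr]|unc].
- by move=> s L'; lia.
- by move=> s L' /and3P[].
- move=> s L' /and3P[FL' sL' prop] st; rewrite leqNgt; apply/negP => tsL'.
  have tL' : t < L by lia.
  by move/(innermost_atFP FL tL'): fr => /(_ s L' st tsL' FL') []; lia.
have [t0|t_gt0] := posnP t; first by constructor 1; apply/eqP.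
have [tL'|tL'] := eqVneq t L; first by constructor 2.
constructor 3; apply/innermost_atFP => //; first lia.
move=> s L' st tsL' FL'; have sL' : s = 0 \/ s + L' <= L.
  have [->|s0] := posnP s; [by left | right].
  by apply: Fnc FL _ FL'; lia.
have [LL'|L'L] := leqP L L'; first by lia.
have := unc s L'; rewrite /proper FL' L'L orbT andbT.
by case: sL' => [s0|sL']; rewrite ?s0 ?add0n in st tsL' *; lia.
Qed.

Lemma cell_consecutive v L a b : F v L -> a < b -> b <= L -> cellp v L a -> cellp v L b ->
  (forall x, a < x < b -> ~~ cellp v L x) -> b = a.+1 \/ proper v L a (b - a).
Proof.
move=> FL ab bL ca cb no; apply: (@consecutive_arc _ L) => //.
- by move=> s L' /and3P[]; lia.
- move=> s L1 t L2 /and3P[F1 s1 p1] tL1 /and3P[F2 s2 p2].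
  by apply: Fnc F1 tL1 _; rewrite -addnA.
- by apply/cellpP => //; lia.
- exact/cellpP.
by move=> x xab; apply/cellpP => //; [lia | apply: no].
Qed.

(** Read from [a], the chord would be a proper arc covering [x]. Read from [b], it would start
    inside [(v, L)] and reach [v + N], or start at its end and run past [v + N]; both contradict
    noncrossing with [(v, L)]. *)
Lemma cell_no_chord v L a b x : F v L -> a < x < b -> b <= L -> cellp v L x ->
  (0 < a) || (b < L) -> [set pt (v + a); pt (v + b)] \notin chords_of.
Proof.
move=> FL axb bL cx ab; have LN := F_lt FL; apply/negP => /chords_ofP.
have xL : x <= L by lia.
have /(cellpP FL xL)/(_ a (b - a)) {cx xL} := cx.
have abE : a + (b - a) = b by lia.
have -> : v + b - (v + a) = b - a by lia.
have -> : v + a + N - (v + b) = a + N - b by lia.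
have abL : (0 < a) || (b - a < L) by lia.
rewrite /proper abE bL abL.
case: (F _ _) => [/(_ isT)|_]; first by lia.
case; [lia | by [] | move=> Fba].
have [bL'|bL'] := eqVneq b L; last by have := nested_arc FL _ Fba; lia.
by have := @nested_arc _ (v + N) _ L Fba; rewrite Fper FL; lia.
Qed.

(** Going around the cell, the sides up to offset [L] come from [cell_consecutive]; the last one,
    from [L] to [N], is the chord of the arc itself. *)
Lemma cell_sides v L a b : F v L -> a < b < a + N -> a <= L -> cellp v L a -> pt (v + b) \in cell v L ->
  (forall x, a < x < b -> pt (v + x) \notin cell v L) ->
  [set pt (v + a); pt (v + b)] \in sides setT :|: chords_of.
Proof.
move=> FL ab aL ca bA no; have LN := F_lt FL.
have c0 : cellp v L 0 by rewrite /cellp eqxx.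
have cL : cellp v L L by rewrite /cellp eqxx orbT.
have [bN|Nb] := ltnP b N.
  rewrite mem_cell // in bA; have [bL cb] := andP bA.
  have [bE|/and3P[Fab _ _]] : b = a.+1 \/ proper v L a (b - a).
  - apply: cell_consecutive => //; first by case/andP: ab.
    move=> x xab; have := no x xab; rewrite mem_cell; last by move: xab bN; clear; lia.
    by rewrite (_ : x <= L) //; move: xab bL; clear; lia.
  - by rewrite bE addnS in_setU side_edge.
  by have := chords_of_sides Fab; rewrite -addnA subnKC //; move: ab; clear; lia.
have bN : b = N.
  apply/eqP; rewrite eqn_leq Nb andbT leqNgt; apply/negP => bN.
  have := no N; rewrite ptD -{1}[v]addn0 mem_cell // c0 /=.
  by move: aL LN bN; clear; lia.
have {}aL : a = L.
  apply/eqP; rewrite eqn_leq aL /= leqNgt; apply/negP => aL'.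
  have := no L; rewrite mem_cell // cL leqnn /=.
  by move: aL' LN bN; clear; lia.
by rewrite bN ptD aL setUC chords_of_sides.
Qed.

Lemma cell_is_cell v L : F v L -> 2 < #|cell v L| /\ is_cell (cell v L).
Proof.
move=> FL; have L1 := Flen FL; have LN := F_lt FL.
split; first by rewrite card_cell // !ltnS (label_gt0 famF).
have memc t : t < N -> pt (v + t) \in cell v L -> t <= L /\ cellp v L t.
  by move=> tN; rewrite mem_cell // => /andP.
have ptadd a b x : pt a = pt b -> pt (a + x) = pt (b + x).
  by move=> /eqP e; apply/eqP; rewrite pt_eq eqn_modDr -pt_eq.
split.
- move=> a0 b0 [ab0 a0A b0A no0]; have [a aN aE] := pt_offset v (pt a0).
  have E x : pt (a0 + x) = pt (v + (a + x)) by rewrite addnA; apply: ptadd.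
  have [d b0E] : exists d, b0 = a0 + d.
    by exists (b0 - a0); rewrite subnKC //; move: ab0; clear; lia.
  have dN : 0 < d < N by move: ab0; rewrite b0E; clear; lia.
  rewrite {}b0E in ab0 b0A no0 *.
  rewrite aE E in a0A b0A *; have [aL ca] := memc _ aN a0A.
  apply: (@cell_sides v L) => //; first by move: dN; clear; lia.
  move=> x xab; have := no0 (a0 + (x - a)); rewrite E subnKC; last by move: xab; clear; lia.
  by apply; move: xab; clear; lia.
move=> a0 x0 b0 y0 axb bya a0A x0A b0A y0A; have [a aN aE] := pt_offset v (pt a0).
have E x : pt (a0 + x) = pt (v + (a + x)) by rewrite addnA; apply: ptadd.
have E' x : N <= a + x -> pt (a0 + x) = pt (v + (a + x - N)).
  by move=> Nx; rewrite E -{1}(subnK Nx) addnA ptD.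
pose x := x0 - a0; pose b := b0 - a0; pose y := y0 - a0.
have [xE bE yE] : [/\ x0 = a0 + x, b0 = a0 + b & y0 = a0 + y].
  by rewrite /x /b /y; move: axb bya; clear; split; lia.
have [ax xb b_y yN] : [/\ 0 < x, x < b, b < y & y < N].
  by rewrite /x /b /y; move: axb bya; clear; split; lia.
move: x b y xE bE yE ax xb b_y yN {axb bya} => x b y xE bE yE x_gt0 xb b_y yN.
rewrite {}xE {}bE {}yE in x0A b0A y0A *.
have [bN|Nb] := ltnP (a + b) N.
  rewrite aE E in a0A b0A *; rewrite E in x0A.
  have [aL ca] := memc _ aN a0A; have [bL cb] := memc _ bN b0A.
  have [|xL cx] := memc _ _ x0A; first by move: xb bN; clear; lia.
  apply: (@cell_no_chord v L _ _ (a + x)) => //.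
    by move: x_gt0 xb; clear; lia.
  have [a_0|//] := posnP a.
  apply/orP; right; rewrite ltn_neqAle bL andbT; apply/negP => /eqP abL.
  rewrite E in y0A; have [|yL _] := memc _ _ y0A; first by move: a_0 yN; clear; lia.
  by move: yL abL b_y; clear; lia.
have Ny : N <= a + y by move: Nb b_y; clear; lia.
rewrite setUC E' // aE in a0A b0A *; rewrite E' // in y0A.
(* The chord wraps past [v]. With its ends exchanged, [y] becomes the point of the cell between
   them. *)
have [aL ca] := memc _ aN a0A.
have [|yL cy] := memc _ _ y0A; first by move: aN yN Ny; clear; lia.
apply: (@cell_no_chord v L _ _ (a + y - N)) => //; first by move: Nb b_y yN Ny; clear; lia.
have [ab0|//] := posnP (a + b - N).
apply/orP; right; rewrite E in x0A.
have [|xL _] := memc _ _ x0A; first by move: ab0 Nb xb; clear; lia.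
by move: xL x_gt0; clear; lia.
Qed.

Definition central_cell : {set 'I_N} := [set x : 'I_N | ~~ covered N F x].

(** With [N <= x], every arc that could cover [x] has a representative whose start is still a
    natural number. *)
Lemma central_cellP x : N <= x -> reflect (uncovered_by F x) (pt x \in central_cell).
Proof.
move=> Nx; rewrite inE; apply: (iffP idP) => [/(coveredP (ltn0Sn _) famF) nc s L FL sx|unc].
  rewrite leqNgt; apply/negP => xsL; apply: nc; exists s, (x - s), L.
  by rewrite subnKC ?modn_mod; [split=> //; lia | lia].
apply/(coveredP (ltn0Sn _) famF) => -[v [t [L [FL tL e]]]].
have L_lt := F_lt FL.
have FxL : F (x - t) L.
  rewrite -(@F_pt v) //; apply/eqP; rewrite pt_eq -(eqn_modDr t) e modn_mod subnK //; lia.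
by have := unc _ _ FxL; lia.
Qed.

Lemma central_cell_is_cell : is_cell central_cell.
Proof.
split=> [a b [ab aK bK no]|a x b y axb bya aK xK bK yK].
  rewrite -(ptD _ a) -(ptD _ b) in aK bK *.
  have [bE|Fab] : b + N = (a + N).+1 \/ F (a + N) (b + N - (a + N)).
  - apply: (@consecutive_arc _ N) => //.
    + by move=> s L /F_lt/ltnW.
    + by rewrite ltn_add2r; case/andP: ab.
    + by apply/central_cellP => //; apply: leq_addl.
    + by apply/central_cellP => //; apply: leq_addl.
    move=> x xab; have Nx : N <= x by move: xab; clear; lia.
    move/(central_cellP Nx); apply/negP; have := no (x - N); rewrite -ptD subnK //.
    by apply; move: xab Nx; clear; lia.
  - by rewrite bE in_setU side_edge.
  by have := chords_of_sides Fab; rewrite subnKC // leq_add2r ltnW //; case/andP: ab.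
apply/negP => /chords_ofP [|Fab|Fba]; first by move: axb bya; clear; lia.
  rewrite -ptD in xK; have /central_cellP u := xK.
  have := u (leq_addl _ _) (a + N) (b - a); rewrite Fper => /(_ Fab).
  by move: axb; clear; lia.
rewrite -ptD in yK; have /central_cellP u := yK.
have := u (leq_addl _ _) (b + N) (a + N - b); rewrite Fper => /(_ Fba).
by move: axb bya; clear; lia.
Qed.

Lemma consecutive_chord A a b : 2 < #|A| -> is_cell A -> consecutive A a b -> b != a.+1 ->
  [set pt a; pt b] \in chords_of.
Proof.
move=> A2 [sA _] ab b_a; have b_lt := consecutive_lt A2 ab; have := sA _ _ ab.
have [ab' _ _ _] := ab; rewrite in_setU => /orP[/(side_setT ab')|//].
by case=> bE; [rewrite bE eqxx in b_a | rewrite bE ltnn in b_lt].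
Qed.

(** Suppose a proper arc covers a point of [A]. An end of it outside [A] would lie under a side of
    [A] that crosses it, so both ends are in [A] and its chord is a forbidden diagonal of [A].
    Conversely, a point of the cell missing from [A] lies in a gap of [A] closed by a chord; as an
    arc, that chord would cover the point or conflict with [(v, L)]. *)
Lemma cell_of_arc A v L : 2 < #|A| -> is_cell A -> F v L -> pt v \in A -> pt (v + L) \in A ->
  (forall x, v + L < x < v + N -> pt x \notin A) -> A = cell v L.
Proof.
move=> A2 cA FL vA LA out; have LN := F_lt FL; have L1 := Flen FL.
apply/setP => z; have [t tN ->] := pt_offset v z; rewrite mem_cell //.
apply/idP/andP => [tA|[tL ct]].
  have tL : t <= L.
    rewrite leqNgt; apply/negP => Lt; have := out (v + t); rewrite tA.
    by move: Lt tN; clear; lia.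
  split=> //; apply/cellpP => // s L' /and3P[FL' sL' prop] st.
  rewrite leqNgt; apply/negP => tsL'.
  have chord : [set pt (v + s); pt (v + s + L')] \in chords_of.
    by apply: mem_chords_of => //; move: prop sL' LN; clear; lia.
  have sA : pt (v + s) \in A.
    apply: contraT => sA; have s_gt0 : 0 < s by case: (s) sA => //; rewrite addn0 vA.
    have [|a' [b' [a's sb' ab']]] := gap_consecutive A2 vA tA _ sA; first by move: s_gt0 st; clear; lia.
    have b'a' : b' != a'.+1 by move: a's sb'; clear; lia.
    have cc := consecutive_chord A2 cA ab' b'a'; exfalso.
    by apply: chords_of_noncrossing cc chord; move: a's sb' st tsL' sL' LN; clear; lia.
  have eA : pt (v + s + L') \in A.
    apply: contraT => eA; have sL'L : s + L' < L.
      rewrite ltn_neqAle sL' andbT; apply/negP => /eqP e; move: eA.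
      by rewrite -addnA e LA.
    have [|a' [b' [a's sb' ab']]] := gap_consecutive A2 tA LA _ eA; first by move: sL'L tsL'; clear; lia.
    have b'a' : b' != a'.+1 by move: a's sb'; clear; lia.
    have cc := consecutive_chord A2 cA ab' b'a'; exfalso.
    by apply: chords_of_noncrossing chord cc; move: a's sb' st tsL' sL' LN; clear; lia.
  have [y [y1 y2 yA]] : exists y, [/\ v + s + L' < y, y < v + s + N & pt y \in A].
    have [e|sL'L] := eqVneq (s + L') L.
      exists (v + N); rewrite ptD; split=> //; move: e prop LN; clear; lia.
    exists (v + L); split=> //; move: sL' sL'L LN; clear; lia.
  case: cA => _ /(_ (v + s) (v + t) (v + s + L') y); rewrite chord sA tA eA yA.
  by move: st tsL' y1 y2; clear; lia.
apply: contraT => tA.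
have t_int : 0 < t < L.
  have [t0|t0] := posnP t; first by rewrite t0 addn0 vA in tA.
  have [tE|tE] := eqVneq t L; first by rewrite tE LA in tA.
  by move: t0 tE tL; clear; lia.
have [|a' [b' [a't tb' ab']]] := gap_consecutive A2 vA LA _ tA; first by move: t_int; clear; lia.
have not_whole : (v < a') || (b' < v + L).
  apply: contraT => whole.
  have [a'E b'E] : a' = v /\ b' = v + L by move: whole a't tb'; clear; lia.
  have [y1 [y2 [vy1 y12 y2N y1A y2A]]] := third_point A2 vA.
  have [_ _ _ no] := ab'; have := no y1; have := out y2; rewrite y1A y2A a'E b'E.
  by move: vy1 y12 y2N; clear; lia.
case: (consecutive_cell A2 cA ab') => [b'E|Fab|Fba].
- by move: a't tb'; rewrite b'E; clear; lia.
- have /(cellpP FL tL)/(_ (a' - v) (b' - a')) := ct.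
  rewrite /proper subnKC; last by move: a't; clear; lia.
  by rewrite Fab; move: a't tb' not_whole; clear; lia.
have [b'E|b'L] := eqVneq b' (v + L).
  have := @nested_arc _ (v + N) _ L Fba; rewrite Fper FL.
  by move: b'E not_whole a't tb' t_int LN; clear; lia.
by have := nested_arc FL _ Fba; move: b'L a't tb' t_int LN; clear; lia.
Qed.

(** If some arc has both ends in [A] and no vertex of [A] strictly outside it, [cell_of_arc]
    applies. Otherwise every gap of [A] is closed by an arc on the side away from [A]: the points in
    the gaps are covered and those of [A] are not. *)
Lemma cell_cases A : 2 < #|A| -> is_cell A -> (exists v L, F v L /\ A = cell v L) \/ A = central_cell.
Proof.
move=> A2 cA.
have [[v [L [FL vA LA out]]]|no_arc] := pselect (exists v L,
    [/\ F v L, pt v \in A, pt (v + L) \in A & forall x, v + L < x < v + N -> pt x \notin A]).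
  by left; exists v, L; rewrite -(cell_of_arc A2 cA FL vA LA out).
right.
(* Read the other way, the side would be an arc with all of [A] on its inner side, the case just
   excluded. *)
have inner a b : consecutive A a b -> b != a.+1 -> F a (b - a).
  move=> ab b_a; case: (consecutive_cell A2 cA ab) => // [bE|Fba].
    by rewrite bE eqxx in b_a.
  case: no_arc; exists b, (a + N - b); have [ab' aA bA no] := ab.
  rewrite subnKC; last by move: ab'; clear; lia.
  rewrite ptD; split=> // x xab; have := no (x - N).
  rewrite -ptD subnK; first by apply; move: xab ab'; clear; lia.
  by move: xab; clear; lia.
have A_gt0 : exists a, pt a \in A.
  have /card_gt0P[a aA] : 0 < #|A| by apply: leq_trans A2.
  by exists a; rewrite pt_val.
(* A representative from [2 * N] on leaves room to step back a full turn. *)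
apply/setP => z; have [x -> Nx] : exists2 x, z = pt x & 2 * N <= x.
  by exists (z + 2 * N); [rewrite ptMD pt_val | apply: leq_addl].
have Nx' : N <= x by move: Nx; clear; lia.
apply/idP/(central_cellP Nx') => [xA v L FL vx|].
  rewrite leqNgt; apply/negP => xL; have LN := F_lt FL.
  have gap y : N <= y -> pt y \notin A -> x < y + N -> y < x + N -> y != x ->
      exists a b, [/\ a < y, y < b, F a (b - a), b - a < N & (x <= a) || (b <= x)].
    move=> Ny yA xyN yxN yx.
    have [xy|yx'] := ltnP x y.
      have xNA : pt (x + N) \in A by rewrite ptD.
      have [|a [b [ay yb ab]]] := gap_consecutive A2 xA xNA _ yA; first by rewrite xy.
      exists a, b; have [ab' _ _ _] := ab; split; try (move: ay yb ab'; clear; lia).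
      by apply: inner => //; move: ay yb; clear; lia.
    have xNA : pt (x - N) \in A.
      by rewrite -ptD subnK //; move: Nx; clear; lia.
    have [|a [b [ay yb ab]]] := gap_consecutive A2 xNA xA _ yA.
      by move: yx yx' xyN Nx; clear; lia.
    exists a, b; have [ab' _ _ _] := ab; split; try (move: ay yb ab'; clear; lia).
    by apply: inner => //; move: ay yb; clear; lia.
  have vA : pt v \in A.
    apply: contraT => vA.
    have [||||a [b [av vb Fab ba xab]]] := gap v _ vA; try (move: Nx vx xL LN; clear; lia).
    by have := nested_arc Fab _ FL; move: av vb xab vx xL; clear; lia.
  have LA : pt (v + L) \in A.
    apply: contraT => LA.
    have [||||a [b [av vb Fab ba xab]]] := gap (v + L) _ LA; try (move: Nx vx xL LN; clear; lia).
    by have := nested_arc FL _ Fab; move: av vb xab vx xL ba; clear; lia.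
  have [y y_out yA] : exists2 y, v + L < y < v + N & pt y \in A.
    apply: contrapT => ny; apply: no_arc; exists v, L; split=> // y y_out.
    by apply/negP => yA; apply: ny; exists y.
  have chord : [set pt v; pt (v + L)] \in chords_of.
    by apply: mem_chords_of => //; move: y_out; clear; lia.
  case: cA => _ /(_ v x (v + L) y); rewrite chord vA xA LA yA.
  by move: vx xL y_out; clear; lia.
move=> unc; apply: contraT => xA; have [a0 a0A] := A_gt0.
have [t tN a0E] := pt_offset (x - N) (pt a0).
have cA' : pt (x - N + t + N) \in A by rewrite ptD -a0E.
rewrite a0E in a0A.
have t0 : t != 0.
  by apply: contraNneq xA => t0; move: cA'; rewrite t0 addn0 subnK //; move: Nx; clear; lia.
have [|a [b [ax xb ab]]] := gap_consecutive A2 a0A cA' _ xA; first by move: t0 tN Nx; clear; lia.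
have := unc a (b - a); rewrite inner //; last by move: ax xb; clear; lia.
by move: ax xb; clear; lia.
Qed.

Lemma cell_start v L : F v L -> pt v \in cell v L.
Proof. by move=> FL; rewrite -{1}[v]addn0 mem_cell // /cellp eqxx. Qed.

Lemma cell_end v L : F v L -> pt (v + L) \in cell v L.
Proof. by move=> /[dup] /F_lt LN FL; rewrite (mem_cell _ _ LN) leqnn /cellp eqxx orbT. Qed.

Lemma cell_out v L x : v + L < x < v + N -> pt x \notin cell v L.
Proof.
move=> x_out; have -> : x = v + (x - v) by move: x_out; clear; lia.
rewrite mem_cell; last by move: x_out; clear; lia.
by rewrite (_ : x - v <= L = false) //; move: x_out; clear; lia.
Qed.

(** Past its last vertex a cell has no point until the turn is complete. This fixes [L] once the
    starts agree, and rules out different starts except when the two arcs follow each other around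
    the polygon. *)
Lemma cell_inj v L v' L' : v < N -> v' < N -> F v L -> F v' L' -> cell v L = cell v' L' ->
  v = v' /\ L = L'.
Proof.
move=> vN v'N FL FL' e; have [s sN v'E] := pt_offset v (pt v').
have FsL' : F (v + s) L' by rewrite -(@F_pt v').
have v'A : pt (v + s) \in cell v L by rewrite -v'E e cell_start.
have L'A : pt (v + s + L') \in cell v L.
  suff -> : pt (v + s + L') = pt (v' + L') by rewrite e cell_end.
  by apply/eqP; rewrite pt_eq eqn_modDr -pt_eq v'E.
have out x : v + s + L' < x < v + s + N -> pt x \notin cell v L.
  move=> x_out; rewrite e; have -> : pt x = pt (v' + (x - (v + s))).
    rewrite -{1}(subnKC (_ : v + s <= x)); last by move: x_out; clear; lia.
    by apply/eqP; rewrite pt_eq eqn_modDr -pt_eq v'E.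
  by apply: cell_out; move: x_out; clear; lia.
have sL : s <= L by move: v'A; rewrite mem_cell // => /andP[].
have LN := F_lt FL; have L'N := F_lt FL'.
have NA : pt (v + N) \in cell v L by rewrite ptD cell_start.
have [s0|s_gt0] := posnP s.
  rewrite s0 addn0 in v'E L'A out; split.
    by apply: (@pt_inj_window n 0); rewrite ?v'E ?add0n //; lia.
  apply/eqP; rewrite eqn_leq; apply/andP; split.
    rewrite leqNgt; apply/negP => lt_L; have := out (v + L); rewrite cell_end //.
    by move: lt_L LN; clear; lia.
  by rewrite leqNgt; apply/negP => lt_L; have := @cell_out v L (v + L'); rewrite L'A;
    move: lt_L L'N; clear; lia.
exfalso; have [s_L|L_s|s_L] := ltngtP s L; last 2 first.
- by move: sL L_s; clear; lia.
(* If the two arcs close up, they are the two readings of one chord, and a common cell would have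
   only its two ends as vertices. *)
- have [LL'|LL'|LL'] := ltngtP (L + L') N.
  + by have := out (v + N); rewrite NA s_L; move: LL' s_gt0 s_L; clear; lia.
  + have := @nested_arc _ (v + N) _ L FsL'; rewrite Fper FL s_L.
    by move: LL' LN L'N s_gt0 s_L; clear; lia.
  have [cell_gt2 _] := cell_is_cell FL.
  have [y1 [y2 [y1_gt y12 y2_lt y1A y2A]]] := third_point cell_gt2 (cell_start FL).
  have y1_lt : y1 < v + L.
    by have := @cell_out v L y2; rewrite y2A; move: y12 y2_lt; clear; lia.
  by have := out (y1 + N); rewrite ptD y1A; move: y1_lt y1_gt LL' s_L; clear; lia.
have s_int : v < v + s < v + L by move: s_gt0 s_L; clear; lia.
have := nested_arc FL s_int FsL'.
by have := out (v + N); rewrite NA; move: s_gt0 s_L LN; clear; lia.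
Qed.

Lemma cell_neq_central_cell v L : F v L -> cell v L <> central_cell.
Proof.
move=> FL e; have [cell_gt2 _] := cell_is_cell FL; have LN := F_lt FL.
have [y1 [y2 [y1_gt y12 y2_lt y1A y2A]]] := third_point cell_gt2 (cell_start FL).
have y1_lt : y1 < v + L.
  by have := @cell_out v L y2; rewrite y2A; move: y12 y2_lt; clear; lia.
move: y1A; rewrite e -ptD => /(central_cellP (leq_addl _ _))/(_ (v + N) L).
by rewrite Fper => /(_ FL); move: y1_gt y1_lt; clear; lia.
Qed.

Lemma cell_per v L : cell (v + N) L = cell v L.
Proof.
apply/setP => x; rewrite !inE ptD /cellp /innermost_at.
under eq_forallb => s do under eq_forallb => L' do rewrite addnAC Fper.
by [].
Qed.

Lemma card_central_cell : #|central_cell| + sumn (all_labels N F) = N.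
Proof.
rewrite -[RHS](card_uncovered (ltn0Sn _) famF); congr (_ + _).
rewrite big_mkord -sum1_card big_mkcond; apply: eq_bigr => x _.
by rewrite inE; case: (covered _ _ _).
Qed.

(** A chord given by two arcs, one in each direction, contributes the cells on both of its sides;
    this happens for a diameter. *)
Lemma perm_pieces : perm_eq (enum (pieces chords_of))
  ([seq cell v L | v <- iota 0 N, L <- arcs_at N F v] ++
   if 2 < #|central_cell| then [:: central_cell] else [::]).
Proof.
have cellsP A : reflect (exists v L, [/\ v < N, F v L & A = cell v L])
    (A \in [seq cell v L | v <- iota 0 N, L <- arcs_at N F v]).
  apply: (iffP idP) => [/allpairsPdep[v [L [vN FL ->]]]|[v [L [vN FL ->]]]].
    by exists v, L; split=> //; [rewrite mem_iota in vN | rewrite -(mem_arcs_at famF)].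
  apply/allpairsPdep; exists v, L.
  by split=> //; [rewrite mem_iota | rewrite (mem_arcs_at famF)].
apply: uniq_perm; first exact: enum_uniq.
  rewrite cat_uniq; apply/and3P; split; last by case: ifP.
    apply: allpairs_uniq_dep; first exact: iota_uniq.
      by move=> v _; apply: filter_uniq; apply: iota_uniq.
    move=> [v L] [v' L'] /allpairsPdep[w [M [wN FM [-> ->]]]] /allpairsPdep[w' [M' [wN' FM' [-> ->]]]] /= e.
    rewrite !mem_iota !(mem_arcs_at famF) in wN wN' FM FM'.
    by have [-> ->] := cell_inj wN wN' FM FM' e.
  case: ifP => // _; rewrite has_seq1; apply/cellsP => -[v [L [_ FL e]]].
  exact: cell_neq_central_cell FL (esym e).
move=> A; rewrite mem_enum mem_cat; apply/piecesP/orP => [[A2 cA]|[/cellsP[v [L [vN FL ->]]]|]].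
- have [[v [L [FL ->]]]|A_K] := cell_cases A2 cA; last by right; rewrite -A_K A2 inE.
  left; apply/cellsP; exists (v %% N), L; rewrite ltn_mod; split=> //.
    by rewrite (@periodic_modn _ N (F^~ L)).
  by rewrite (@periodic_modn _ N (cell ^~ L)) // => w; apply: cell_per.
- exact: cell_is_cell.
case: ifP => // K2; rewrite inE => /eqP ->; split=> //; exact: central_cell_is_cell.
Qed.

Lemma piece_sizes : perm_eq [seq #|A| | A : {set 'I_N} in pieces chords_of]
  ([seq l.+2 | l <- all_labels N F] ++ if 2 < #|central_cell| then [:: #|central_cell|] else [::]).
Proof.
have -> : [seq l.+2 | l <- all_labels N F] ++ (if 2 < #|central_cell| then [:: #|central_cell|] else [::]) =
  [seq (fun A : {set 'I_N} => #|A|) A | A <- [seq cell v L | v <- iota 0 N, L <- arcs_at N F v] ++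
   if 2 < #|central_cell| then [:: central_cell] else [::]].
  rewrite map_cat; congr (_ ++ _); last by case: ifP.
  rewrite /all_labels !map_flatten -!map_comp; congr flatten; apply: eq_map => v /=.
  rewrite -!map_comp; apply/eq_in_map => L; rewrite (mem_arcs_at famF) /= => FL.
  by rewrite card_cell.
by apply: perm_map; apply: perm_pieces.
Qed.

End Pieces.

(** * Rotations *)

Section Rotation.
Variable n : nat.
Local Notation N := n.+2.
Local Notation pt := (@pt n).
Implicit Types (A : {set 'I_N}) (D : {set {set 'I_N}}).

Definition rot_set k A : {set 'I_N} := [set (x + pt k)%R | x in A].

Definition rot_chords k D : {set {set 'I_N}} := [set rot_set k e | e in D].

Lemma ptDr x k : pt (x + k) = (pt x + pt k)%R.
Proof. by apply/val_inj; rewrite [RHS]/= modnDm. Qed.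

Lemma rotationE k D : rotation n D (pt k) = rot_chords k D.
Proof. by []. Qed.

Lemma rot_set_inj k : injective (rot_set k).
Proof. by apply: imset_inj; apply: addIr. Qed.

Lemma mem_rot_set k A x : (pt (x + k) \in rot_set k A) = (pt x \in A).
Proof. by rewrite ptDr; apply: (mem_imset _ _ (addIr (pt k))). Qed.

Lemma rot_set2 k a b : rot_set k [set pt a; pt b] = [set pt (a + k); pt (b + k)].
Proof. by rewrite /rot_set imsetU1 imset_set1 -!ptDr. Qed.

Lemma rot_setT k : rot_set k setT = setT.
Proof.
apply/setP => x; rewrite inE; apply/imsetP; exists (x - pt k)%R; first by rewrite inE.
by rewrite subrK.
Qed.

(** Since [k + k * n.+1] is a multiple of [N], the inverse of a rotation is again of the form
    [rot_set], so one implication suffices in the invariance lemmas. *)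
Lemma rot_setN k A : rot_set (k * n.+1) (rot_set k A) = A.
Proof.
rewrite /rot_set -imset_comp -[RHS]imset_id; apply: eq_imset => x /=.
rewrite -addrA -ptDr -mulnS -[k * N]add0n ptMD.
by have -> : pt 0 = 0%R; [apply/val_inj | rewrite addr0].
Qed.

Lemma rot_setNV k A : rot_set k (rot_set (k * n.+1) A) = A.
Proof. by apply: (@rot_set_inj (k * n.+1)); rewrite rot_setN. Qed.

Lemma rot_chordsN k D : rot_chords (k * n.+1) (rot_chords k D) = D.
Proof.
rewrite /rot_chords -imset_comp -[RHS]imset_id; apply: eq_imset => e /=.
exact: rot_setN.
Qed.

Lemma mem_rot_chords k D e : (rot_set k e \in rot_chords k D) = (e \in D).
Proof. exact: (mem_imset _ _ (@rot_set_inj k)). Qed.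

Lemma card_rot_set k A : #|rot_set k A| = #|A|.
Proof. by rewrite card_imset //; apply: addIr. Qed.

Lemma sides_rot_le k A e : e \in sides A -> rot_set k e \in sides (rot_set k A).
Proof.
case/sidesP => a [b [[ab aA bA no] ->]]; apply/sidesP; exists (a + k), (b + k).
rewrite rot_set2; split=> //; split; rewrite ?mem_rot_set //; first by move: ab; clear; lia.
move=> x xab; have -> : x = x - k + k by move: xab; clear; lia.
by rewrite mem_rot_set; apply: no; move: xab; clear; lia.
Qed.

Lemma sides_rot k A e : (rot_set k e \in sides (rot_set k A)) = (e \in sides A).
Proof.
apply/idP/idP => [/(sides_rot_le (k * n.+1))|/(sides_rot_le k)] //.
by rewrite !rot_setN.
Qed.

Lemma diagonals_rot k A e : (rot_set k e \in diagonals (rot_set k A)) = (e \in diagonals A).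
Proof.
rewrite !in_setD sides_rot !in_set card_rot_set; congr (_ && (_ && _)).
by apply/idP/idP => [|]; [|exact: imsetS]; move/(imsetS (fun x => (x + pt (k * n.+1))%R));
  rewrite -!/(rot_set _ _) !rot_setN.
Qed.

Lemma crossing_rot_le k e f : crossing e f -> crossing (rot_set k e) (rot_set k f).
Proof.
case/crossingP => a [c [b [d [acb bda -> ->]]]]; apply/crossingP.
exists (a + k), (c + k), (b + k), (d + k); rewrite !rot_set2.
by split=> //; move: acb bda; clear; lia.
Qed.

Lemma dissection_rot k D : dissection D -> dissection (rot_chords k D).
Proof.
case/andP => /subsetP D_diag /forallP ncD; apply/andP; split.
  apply/subsetP => _ /imsetP[e eD ->]; rewrite -(rot_setT k) diagonals_rot.
  exact: D_diag.
apply/forallP => e'; apply/implyP => /imsetP[e eD ->].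
apply/forallP => f'; apply/implyP => /imsetP[f fD ->].
apply/negP => /(crossing_rot_le (k * n.+1)); rewrite !rot_setN => efX.
have /implyP/(_ eD)/forallP/(_ f)/implyP/(_ fD) := ncD e.
by rewrite efX.
Qed.

Lemma pieces_rot_le k D A : A \in pieces D -> rot_set k A \in pieces (rot_chords k D).
Proof.
rewrite !inE => /and3P[A2 /subsetP sA dA]; rewrite card_rot_set A2 /=; apply/andP; split.
  apply/subsetP => e; rewrite -(rot_setNV k e) sides_rot => /sA; rewrite !in_setU.
  by rewrite mem_rot_chords -[in X in _ -> X || _](rot_setT k) sides_rot.
apply/pred0P => e /=; apply/negP; rewrite -(rot_setNV k e) diagonals_rot mem_rot_chords.
by have /pred0P/(_ (rot_set (k * n.+1) e))/= -> := dA.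
Qed.

Lemma pieces_rot k D : pieces (rot_chords k D) = [set rot_set k A | A in pieces D].
Proof.
apply/setP => A; apply/idP/imsetP => [A_piece|[B B_piece ->]]; last exact: pieces_rot_le.
exists (rot_set (k * n.+1) A); last by rewrite rot_setNV.
by have := pieces_rot_le (k * n.+1) A_piece; rewrite rot_chordsN.
Qed.

Lemma dissections_of_type_rot_le k la D :
  D \in dissections_of_type n la -> rot_chords k D \in dissections_of_type n la.
Proof.
rewrite !inE => /andP[disD typeD]; rewrite dissection_rot //=; apply: perm_trans typeD.
have p : perm_eq (enum (pieces (rot_chords k D))) [seq rot_set k A | A <- enum (pieces D)].
  apply: uniq_perm; rewrite ?enum_uniq ?(map_inj_uniq (@rot_set_inj k)) ?enum_uniq // => A.
  rewrite mem_enum pieces_rot; apply/imsetP/mapP => -[B BD ->]; exists B => //.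
    by rewrite mem_enum.
  by rewrite mem_enum in BD.
have := perm_map (fun A : {set 'I_N} => #|A|) p; rewrite -map_comp.
by rewrite /= (eq_map (card_rot_set k)).
Qed.

Lemma rotation_acts la : [acts [set: 'I_N], on dissections_of_type n la | rotation n].
Proof.
apply/actsP => g _ D; rewrite -(pt_val g) rotationE.
apply/idP/idP; last exact: dissections_of_type_rot_le.
by move/(dissections_of_type_rot_le (g * n.+1)); rewrite rot_chordsN.
Qed.

Lemma rotation_cyclic : cyclic [set: 'I_N].
Proof. by apply/cyclicP; exists Zp1; rewrite -Zp_cycle. Qed.

Lemma order_pt d m : N = d * m -> #[pt m]%g = d.
Proof.
move=> dm; have -> : pt m = (@Zp1 n.+1 ^+ m)%g.
  by rewrite Zp_expg; apply/val_inj; rewrite /= modnMml mul1n.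
have m_gt0 : 0 < m by case: (m) dm => //; rewrite muln0.
by rewrite orderXdiv order_Zp1 dm ?mulnK // dvdn_mull.
Qed.

Lemma order_dvd (g : 'I_N) : #[g]%g %| N.
Proof. by rewrite -[X in _ %| X](card_ord N) -cardsT order_dvdG ?inE. Qed.

(** A cyclic group has only one subgroup of order [d], so [g] may be replaced by the rotation by
    [m]. *)
Lemma fix_rotation (S : {set {set {set 'I_N}}}) (g : 'I_N) d m : N = d * m -> #[g]%g = d ->
  'Fix_(S | rotation n)[g]%g = [set D in S | rot_chords m D == D].
Proof.
move=> dm gd; rewrite -afix_cycle.
have -> : <[g]>%g = <[pt m]>%g.
  apply/eqP; rewrite (eq_subG_cyclic rotation_cyclic) ?subsetT //.
  by rewrite -!orderE gd (order_pt dm).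
by rewrite afix_cycle; apply/setP => D; rewrite !inE sub1set inE rotationE.
Qed.

End Rotation.

(** * Dissections with rotational symmetry *)

Lemma dissection_noncrossing n (D : {set {set 'I_n.+2}}) a c b d : dissection D ->
  a < c < b -> b < d < a + n.+2 -> [set pt n a; pt n b] \in D -> [set pt n c; pt n d] \in D -> False.
Proof.
move=> /andP[_ /forallP nc] acb bda abD cdD.
have /implyP/(_ abD)/forallP/(_ [set pt n c; pt n d])/implyP/(_ cdD)/negP := nc [set pt n a; pt n b].
by apply; apply/crossingP; exists a, c, b, d.
Qed.

Lemma dissection_chord n (D : {set {set 'I_n.+2}}) e : dissection D -> e \in D ->
  exists a b, [/\ a.+1 < b, b.+1 < a + n.+2, a < n.+2, b < n.+2 & e = [set pt n a; pt n b]].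
Proof.
move=> /andP[/subsetP D_diag _] /D_diag /diagonalsP[a0 [x [b0 [y [axb bya _ ->]]]]].
have ptmod x' : pt n x' = pt n (x' %% n.+2) by apply/eqP; rewrite pt_eq modn_mod.
have [a aE] : exists2 a, a < n.+2 & pt n a0 = pt n a.
  by exists (a0 %% n.+2); rewrite ?ltn_mod // -ptmod.
have [t tE] : exists t, [/\ b0 = a0 + t, 1 < t & t.+1 < n.+2].
  by exists (b0 - a0); move: axb bya; clear; split; lia.
case: tE => b0E t1 tN a0E.
have b0E' : pt n b0 = pt n (a + t).
  by rewrite b0E; apply/eqP; rewrite pt_eq eqn_modDr -pt_eq a0E.
rewrite a0E b0E'; have [atN|Nat] := ltnP (a + t) n.+2.
  by exists a, (a + t); split=> //; move: t1 tN; clear; lia.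
exists (a + t - n.+2), a; rewrite setUC -(ptD n (a + t - n.+2)) subnK //.
by split=> //; move: aE Nat t1 tN; clear; lia.
Qed.

Section Symmetric.
Variables n d m : nat.
Local Notation N := n.+2.
Local Notation pt := (@pt n).
Hypothesis dm : N = d * m.
Hypothesis d_gt1 : 1 < d.
Implicit Types (F : nat -> nat -> bool) (D : {set {set 'I_N}}).

Let m_gt0 : 0 < m. Proof. by case: (m) dm => //; rewrite muln0. Qed.
Let mN : m + m <= N. Proof. by rewrite dm addnn -mul2n leq_mul2r d_gt1 orbT. Qed.

(** The same predicate describes arcs on both circles, since a period [m] is also a period [N]. *)
Lemma symmetric_family F : arc_family m F -> arc_family N F.
Proof.
case=> Fper Flen Fnc; split=> // [v L|v L /Flen].
  by rewrite dm (@periodicM m _ (F^~ L)).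
by move: mN; clear; lia.
Qed.

Lemma symmetric_lt F v L : arc_family m F -> F v L -> L < N.
Proof. by case=> _ Flen _ /Flen; move: mN m_gt0; clear; lia. Qed.

Lemma symmetric_labels_at F v : arc_family m F -> labels_at N F v = labels_at m F v.
Proof.
move=> [_ Flen _]; rewrite /labels_at (@arcs_at_widen m) // => [L /Flen/andP[]//|].
by move: mN; clear; lia.
Qed.

Lemma symmetric_labels F : arc_family m F ->
  all_labels N F = flatten (nseq d (all_labels m F)).
Proof.
move=> famF; rewrite /all_labels (eq_map (fun v => symmetric_labels_at v famF)) dm.
elim: (d) => // k IH; rewrite mulSn iotaD map_cat flatten_cat /=; congr (_ ++ _).
rewrite -IH add0n (_ : iota m _ = map (addn m) (iota 0 (k * m))); last by rewrite -iotaDl addn0.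
by rewrite -map_comp; congr flatten; apply: eq_map => v /=; rewrite addnC (labels_at_per famF).
Qed.

(** Only a diameter can be read from either end with length at most [m], and there the period [m]
    makes both readings agree. Hence the chords determine the family. *)
Lemma symmetric_chord F v L : arc_family m F ->
  F v L = (1 < L <= m) && ([set pt v; pt (v + L)] \in chords_of n F).
Proof.
move=> famF; have famN := symmetric_family famF.
have F_lt v' L' : F v' L' -> L' < N by exact: symmetric_lt.
have [Fper Flen _] := famF.
apply/idP/andP => [FL|[Lm]].
  have Lm := Flen _ _ FL; split=> //.
  by apply: mem_chords_of => //; move: Lm mN; clear; lia.
case/(chords_ofP famN F_lt); first by move: Lm mN; clear; lia.
  by rewrite addKn.
have -> : v + N - (v + L) = N - L by move: Lm; clear; lia.
move=> F'; have := Flen _ _ F'; have Lm' : L <= m by case/andP: Lm.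
move=> F'm; have LE : L = m /\ N - L = m by move: F'm Lm' mN; clear; lia.
by case: LE => Lm0 NL; move: F'; rewrite NL Lm0 Fper.
Qed.

Lemma chords_of_inj F F' : arc_family m F -> arc_family m F' ->
  chords_of n F = chords_of n F' -> F = F'.
Proof.
move=> fam fam' e; apply/funext => v; apply/funext => L.
by rewrite (symmetric_chord _ _ fam) (symmetric_chord _ _ fam') e.
Qed.

Lemma chords_of_symmetric F : arc_family m F -> rot_chords m (chords_of n F) = chords_of n F.
Proof.
move=> famF; have [Fper _ _] := famF.
apply/eqP; rewrite eqEcard card_imset ?leqnn ?andbT; last exact: rot_set_inj.
apply/subsetP => _ /imsetP[e + ->]; rewrite inE => /andP[e_diag /asboolP[v [L [FL eE]]]].
rewrite inE -(rot_setT n m) diagonals_rot e_diag; apply/asboolP; exists (v + m), L.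
by rewrite Fper eE rot_set2 addnAC.
Qed.

Definition arcs_from D v L := (1 < L <= m) && ([set pt v; pt (v + L)] \in D).

Section OfDissection.
Variable D : {set {set 'I_N}}.
Hypothesis disD : dissection D.
Hypothesis symD : rot_chords m D = D.

Lemma rot_chord a b : ([set pt (a + m); pt (b + m)] \in D) = ([set pt a; pt b] \in D).
Proof. by rewrite -rot_set2 -{1}symD mem_rot_chords. Qed.

Lemma arcs_from_family : arc_family m (arcs_from D).
Proof.
split=> [v L|v L /andP[]//|v L t L' /andP[Lm vD] tL /andP[L'm v'D]].
  by rewrite /arcs_from addnAC rot_chord.
rewrite leqNgt; apply/negP => tL'; apply: (dissection_noncrossing disD _ _ vD v'D).
  by move: tL; clear; lia.
by move: tL tL' Lm L'm mN; clear; lia.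
Qed.

(* A diagonal longer than [m] would cross its own rotation by [m]. *)
Lemma short_chord a b : a < b < a + N -> [set pt a; pt b] \in D -> b - a <= m \/ a + N - b <= m.
Proof.
move=> ab abD; have [|m_ba] := leqP (b - a) m; first by left.
have [|m_ab] := leqP (a + N - b) m; first by right.
exfalso; apply: (@dissection_noncrossing _ _ a (a + m) b (b + m) disD) => //.
- by move: m_ba m_gt0; clear; lia.
- by move: m_ab m_gt0; clear; lia.
by rewrite rot_chord.
Qed.

Lemma chords_of_arcs_from : chords_of n (arcs_from D) = D.
Proof.
apply/setP => e; apply/idP/idP => [|eD].
  by rewrite inE => /andP[_ /asboolP[v [L [/andP[_ vD] ->]]]].
have [a [b [ab ba _ _ eE]]] := dissection_chord disD eD.
rewrite inE; apply/andP; split; first by case/andP: disD => /subsetP/(_ _ eD).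
apply/asboolP; rewrite eE in eD *.
case: (short_chord _ eD) => [|Lm|Lm]; first by move: ab ba; clear; lia.
  exists a, (b - a); rewrite /arcs_from subnKC ?eD ?andbT ?Lm; last by move: ab; clear; lia.
  by split=> //; move: ab; clear; lia.
exists b, (a + N - b); rewrite /arcs_from subnKC; last by move: ba; clear; lia.
rewrite ptD setUC eD Lm !andbT; split=> //; move: ba; clear; lia.
Qed.

End OfDissection.

Lemma symmetric_type F la : arc_family m F ->
  (chords_of n F \in dissections_of_type n la) =
  perm_eq ([seq l.+2 | l <- flatten (nseq d (all_labels m F))] ++
           if 2 < N - d * sumn (all_labels m F) then [:: N - d * sumn (all_labels m F)] else [::])
          [seq k.+2 | k <- la].
Proof.
move=> famF; have famN := symmetric_family famF.
have F_lt v' L' : F v' L' -> L' < N by exact: symmetric_lt.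
rewrite inE dissection_chords_of //=.
have := piece_sizes famN F_lt; have := card_central_cell famN.
rewrite (symmetric_labels famF) sumn_flatten map_nseq sumn_nseq => K.
have -> : #|central_cell n F| = N - d * sumn (all_labels m F).
  by move: K; rewrite mulnC; move: #|_| => k; clear; lia.
by move/permPl => ->.
Qed.

(** The test on labels is left abstract because it is used in two forms: constantly false when no
    invariant dissection has the type, and a prescribed multiset of labels otherwise. *)
Lemma card_symmetric la (nu_ok : seq nat -> bool) :
  (forall F, arc_family m F -> (chords_of n F \in dissections_of_type n la) = nu_ok (all_labels m F)) ->
  #|[set D in dissections_of_type n la | rot_chords m D == D]| =
  #|[set S : {set 'I_m * 'I_m.+1} | `[< arc_family m (arcs_fun S) >] & nu_ok (all_labels m (arcs_fun S))]|.
Proof.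
move=> okP; pose f (S : {set 'I_m * 'I_m.+1}) := chords_of n (arcs_fun S).
rewrite -(card_in_imset (f := f)) => [|S1 S2]; last first.
  rewrite !inE => /andP[/asboolP fam1 _] /andP[/asboolP fam2 _] /(chords_of_inj fam1 fam2) e.
  by rewrite -(arcs_funK S1) -(arcs_funK S2) e.
apply: eq_card => D; apply/idP/imsetP => [|[S]].
  rewrite inE => /andP[D_type /eqP symD].
  have disD : dissection D by move: D_type; rewrite inE => /andP[].
  have fam := arcs_from_family disD symD.
  exists (arcs_set m (arcs_from D)).
    by rewrite inE arcs_setK // -okP // chords_of_arcs_from // D_type andbT; apply/asboolP.
  by rewrite /f arcs_setK // chords_of_arcs_from.
rewrite inE => /andP[/asboolP fam ok] ->.
by rewrite inE okP // ok /= chords_of_symmetric.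
Qed.

End Symmetric.

(** * Multiplicities modulo [d] and the number of invariant dissections *)

Lemma perm_countP (s t : seq nat) :
  reflect (forall x, count_mem x s = count_mem x t) (perm_eq s t).
Proof.
apply: (iffP idP) => [/seq.permP e x|e]; first exact: e.
by apply/allP => x _ /=; rewrite e.
Qed.

Lemma sumn_count n (s : seq nat) : all (fun x => x <= n) s ->
  sumn s = \sum_(i < n.+1) i * count_mem (i : nat) s.
Proof.
elim: s => [|x s IH] /=; first by rewrite big1 // => i _; rewrite muln0.
case/andP => xn /IH ->.
under [RHS]eq_bigr do rewrite mulnDr; rewrite big_split /=; congr (_ + _).
rewrite (bigD1 (Ordinal (xn : x < n.+1))) //= eqxx muln1 big1 ?addn0 // => i /eqP ix.
case: eqP => [e|]; last by rewrite muln0.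
by case: ix; apply/val_inj.
Qed.

Lemma size_count n (s : seq nat) : all (fun x => x <= n) s ->
  size s = \sum_(i < n.+1) count_mem (i : nat) s.
Proof.
elim: s => [|x s IH] /=; first by rewrite big1.
case/andP => xn /IH ->; rewrite big_split /= -[LHS]add1n; congr (_ + _).
rewrite (bigD1 (Ordinal (xn : x < n.+1))) //= eqxx big1 ?addn0 // => i /eqP ix.
by case: eqP => // e; case: ix; apply/val_inj.
Qed.

Lemma card_families_count m n nu : 0 < m -> all (leq 1) nu -> all (fun x => x <= n) nu ->
  sumn nu < m ->
  #|families m nu| * (m.-1`! * \prod_(1 <= i < n.+1) (count_mem i nu)`!) = (m.-1 + size nu)`!.
Proof.
move=> m_gt0 nu_pos nu_le nu_sum.
have uT : uniq (iota 0 n.+1) by exact: iota_uniq.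
have sT : {subset nseq m.-1 0 ++ nu <= iota 0 n.+1}.
  move=> x; rewrite mem_cat mem_iota => /orP[/nseqP[-> _]//|/(allP nu_le)]; lia.
have := size_permutations_count uT sT; rewrite -card_families // size_cat size_nseq => <-.
congr (_ * _); rewrite /= big_cons; congr (_ * _).
  congr (_`!); rewrite count_cat count_nseq mul1n.
  rewrite (_ : count _ nu = 0) ?addn0 //; apply/eqP; rewrite -leqn0 leqNgt -has_count has_pred1.
  by apply/negP => /(allP nu_pos).
rewrite /index_iota subn1 /= big_seq [RHS]big_seq; apply: eq_bigr => i; rewrite mem_iota => i_gt.
by rewrite count_cat count_nseq /=; case: i i_gt.
Qed.

Section FixedCount.
Variables n d m : nat.
Local Notation N := n.+2.
Hypothesis dm : N = d * m.
Hypothesis d_gt1 : 1 < d.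
Variable la : seq nat.
Hypothesis la_pos : all (leq 1) la.
Hypothesis la_sum : sumn la = n.

Let mult i := count_mem i la.

(** One label for each full orbit of [d] pieces. *)
Definition quotient_type := flatten [seq nseq (count_mem i la %/ d) i | i <- iota 0 n.+1].

Let la_le : all (fun x => x <= n) la.
Proof.
apply/allP => x xla; rewrite -la_sum; elim: (la) xla => //= y s IH; rewrite inE => /orP[/eqP->|/IH]; lia.
Qed.

Let mult_out i : ~~ (0 < i <= n) -> mult i = 0.
Proof.
move=> i_out; apply/eqP; rewrite -leqn0 leqNgt -has_count has_pred1; apply/negP => i_la.
by move/negP: i_out; apply; rewrite (allP la_pos i i_la) (allP la_le i i_la).
Qed.

Lemma count_quotient_type i : count_mem i quotient_type = mult i %/ d.
Proof.
rewrite count_flatten -map_comp sumnE big_map /=.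
have [i_in|i_out] := boolP (i \in iota 0 n.+1); last first.
  rewrite big1_seq => [|j /andP[_ j_in]]; last first.
    rewrite count_nseq /=; case: eqP => [ji|]; last by rewrite mul0n.
    by rewrite -ji j_in in i_out.
  by rewrite mult_out ?div0n //; move: i_out; rewrite mem_iota; lia.
rewrite (bigD1_seq i i_in (iota_uniq _ _)) /= count_nseq /= eqxx mul1n big1 ?addn0 // => j ji.
by rewrite count_nseq /= (negPf ji) mul0n.
Qed.

Let nu_ok nu := perm_eq ([seq l.+2 | l <- flatten (nseq d nu)] ++
           if 2 < N - d * sumn nu then [:: N - d * sumn nu] else [::])
          [seq k.+2 | k <- la].

(** [n - d * sumn nu] is the part belonging to the central piece, its number of vertices minus 2; it
    is 0 when there is no such piece. *)
Lemma nu_okP nu : reflect (forall i, d * count_mem i nu +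
   ((0 < n - d * sumn nu) && (i == n - d * sumn nu)) = mult i) (nu_ok nu).
Proof.
pose k := n - d * sumn nu.
have -> : nu_ok nu = perm_eq (flatten (nseq d nu) ++ if 0 < k then [:: k] else [::]) la.
  rewrite /nu_ok; have -> : (if 2 < N - d * sumn nu then [:: N - d * sumn nu] else [::]) =
      [seq l.+2 | l <- if 0 < k then [:: k] else [::]].
    rewrite /k; have [k_gt0|] := ltnP 0 (n - d * sumn nu).
      have -> : N - d * sumn nu = (n - d * sumn nu).+2 by lia.
      by rewrite !ltnS k_gt0.
    by case: ltnP => //; lia.
  rewrite -map_cat; apply/idP/idP => [|/perm_map]; last by apply.
  by apply: perm_map_inj => x y [].
have E i : count_mem i (flatten (nseq d nu) ++ if 0 < k then [:: k] else [::]) =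
   d * count_mem i nu + ((0 < k) && (i == k)).
  rewrite count_cat count_flatten map_nseq sumn_nseq mulnC; congr (_ + _).
  by case: ifP => //= _; rewrite addn0 eq_sym.
by apply: (iffP (perm_countP _ _)) => e i; [rewrite -E; apply: e | rewrite E; apply: e].
Qed.

(** The central piece adds at most 1, which is less than [d], to one multiplicity; so it is the
    remainder and the labels give the quotients. *)
Lemma nu_ok_rest nu : nu_ok nu ->
  perm_eq nu quotient_type /\ \sum_(i < n.+1) mult i %% d <= 1.
Proof.
move/nu_okP => e; have d_gt0 : 0 < d by apply: ltnW.
have b_lt (b : bool) : b < d by case: b.
split.
  apply/perm_countP => i; rewrite count_quotient_type -e.
  by rewrite mulnC divnMDl // divn_small // addn0.
apply: (@leq_trans (\sum_(i < n.+1) (i == n - d * sumn nu :> nat))).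
  apply: leq_sum => i _; rewrite -e mulnC modnMDl modn_small //.
  by case: (0 < _).
have nu_n : n - d * sumn nu < n.+1 by rewrite ltnS leq_subr.
rewrite (bigD1 (Ordinal nu_n)) //= eqxx big1 // => i /eqP ni.
by case: eqP => // ie; case: ni; apply/val_inj.
Qed.

Lemma sumn_quotient_type :
  n = d * sumn quotient_type + \sum_(i < n.+1) i * (mult i %% d).
Proof.
have le : all (fun x => x <= n) quotient_type.
  apply/allP => x /flattenP[_ /mapP[i i_in ->]] /nseqP[-> _].
  by move: i_in; rewrite mem_iota; lia.
rewrite -{1}la_sum (sumn_count la_le) (sumn_count le) big_distrr -big_split.
apply: eq_bigr => i _ /=; rewrite count_quotient_type -/(mult i) {1}(divn_eq (mult i) d).
by rewrite mulnDr [_ * d]mulnC (mulnCA i).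
Qed.

(** The size of the central piece is forced by the total [n], and [sumn_quotient_type] shows that it
    is the one leftover part, or 0 if all remainders vanish. *)
Lemma nu_okE nu : \sum_(i < n.+1) mult i %% d <= 1 -> nu_ok nu = perm_eq nu quotient_type.
Proof.
move=> rest; apply/idP/idP => [/nu_ok_rest[]//|nuE].
have nu_sum : sumn nu = sumn quotient_type by apply: perm_sumn.
have d_gt0 : 0 < d by apply: ltnW.
apply/nu_okP => i; rewrite nu_sum.
have -> : n - d * sumn quotient_type = \sum_(i < n.+1) i * (mult i %% d).
  by rewrite {1}sumn_quotient_type addKn.
rewrite (perm_countP _ _ nuE) count_quotient_type mulnC [RHS](divn_eq _ d); congr (_ + _).
have [r0|[j rj]] : (forall j : 'I_n.+1, mult j %% d = 0) \/ exists j : 'I_n.+1, mult j %% d != 0.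
  have [/existsP[j rj]|/existsPn h] := boolP [exists j : 'I_n.+1, mult j %% d != 0].
    by right; exists j.
  by left => j; apply/eqP; rewrite -[_ == _]negbK.
  rewrite big1 /=; last by move=> j _; rewrite r0 muln0.
  have [i_n|n_i] := ltnP i n.+1; first by rewrite (r0 (Ordinal i_n)).
  by rewrite mult_out ?mod0n //; lia.
have {}rest : mult j %% d + \sum_(l < n.+1 | l != j) mult l %% d <= 1.
  by move: rest; rewrite (bigD1 j).
have rj1 : mult j %% d = 1 by lia.
have r0 (l : 'I_n.+1) : l != j -> mult l %% d = 0.
  move=> lj; apply/eqP; rewrite -leqn0.
  have : \sum_(l < n.+1 | l != j) mult l %% d <= 0.
    by move: rest rj1; move: (\sum_(_ < _ | _) _) (mult j %% d) => x y; clear; lia.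
  by apply: leq_trans; rewrite (bigD1 l) //= leq_addr.
have -> : \sum_(i < n.+1) i * (mult i %% d) = j.
  rewrite (bigD1 j) //= rj1 muln1 big1 ?addn0 // => l lj.
  by rewrite r0 // muln0.
have j_gt0 : 0 < j.
  by rewrite lt0n; apply: contra rj => /eqP ->; rewrite mult_out ?mod0n.
rewrite j_gt0 /=; have [->|ij] := eqVneq i j; first by rewrite rj1.
have [i_n|n_i] := ltnP i n.+1; last by rewrite mult_out ?mod0n //; lia.
by rewrite (r0 (Ordinal i_n)).
Qed.

Lemma card_fixed : 
  let S := [set D in dissections_of_type n la | rot_chords m D == D] in
  if \sum_(i < n.+1) mult i %% d <= 1 then
    #|S| * (m.-1`! * \prod_(1 <= i < n.+1) (mult i %/ d)`!) =
    (m.-1 + \sum_(1 <= i < n.+1) mult i %/ d)`!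
  else #|S| = 0.
Proof.
have m_gt0 : 0 < m by case: (m) dm => //; rewrite muln0.
move=> S; case: ifP => rest; last first.
  apply: (etrans (@card_symmetric n d m dm d_gt1 la (fun _ => false) _)).
    move=> F famF; rewrite (symmetric_type dm d_gt1 _ famF); apply/negP => /nu_ok_rest[_].
    by rewrite rest.
  by apply: eq_card0 => F; rewrite !inE andbF.
have -> : #|S| = #|families m quotient_type|.
  apply: (@card_symmetric n d m dm d_gt1 la (fun nu => perm_eq nu quotient_type)).
  by move=> F famF; rewrite (symmetric_type dm d_gt1 _ famF); apply: nu_okE.
have le : all (fun x => x <= n) quotient_type.
  apply/allP => x /flattenP[_ /mapP[i i_in ->]] /nseqP[-> _].
  by move: i_in; rewrite mem_iota; lia.
have pos : all (leq 1) quotient_type.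
  apply/allP => x; rewrite -has_pred1 has_count count_quotient_type.
  by case: x => //; rewrite mult_out // div0n.
have sum_lt : sumn quotient_type < m.
  have d_gt0 : 0 < d by apply: ltnW.
  rewrite -(ltn_pmul2l d_gt0) -dm; move: sumn_quotient_type; move: (\sum_(i < _) _) (sumn _) => x y; lia.
rewrite -[X in (_ + X)`!](_ : size quotient_type = _).
  rewrite -(card_families_count m_gt0 pos le sum_lt); congr (_ * (_ * _)).
  by apply: eq_bigr => i _; rewrite count_quotient_type.
rewrite (size_count le) -(big_mkord predT (fun i => count_mem i quotient_type)) [LHS]big_ltn //.
rewrite count_quotient_type mult_out // div0n add0n.
by apply: eq_bigr => i _; rewrite count_quotient_type.
Qed.

End FixedCount.

(** * All dissections *)

Section Rooted.
Variable n : nat.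
Local Notation N := n.+2.
Local Notation m := n.+1.
Local Notation pt := (@pt n).
Implicit Types (F : nat -> nat -> bool) (D : {set {set 'I_N}}).

(* Vertex [n.+1] of the polygon and vertex [0] are identified on the circle
   with [n.+1] points, where the root side becomes a loop at [0]. *)
Definition cut_arcs F v L := (v %% N < m) && F (v %% N) L.

Definition rooted F := arc_family m F /\ ~~ covered m F 0.

Section Cut.
Variable F : nat -> nat -> bool.
Hypothesis rootF : rooted F.

Let famF : arc_family m F. Proof. by case: rootF. Qed.
Let Fle v L : v < m -> F v L -> v + L <= m.
Proof. by case: rootF => _ unc; apply: (uncovered0_arc (ltn0Sn n) famF unc). Qed.

Lemma cut_arcs_lt v L : cut_arcs F v L -> L < N.
Proof. by case/andP => vm /(Fle vm); move: (v %% N) => x; clear; lia. Qed.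

Lemma cut_arcsE a L : a < m -> cut_arcs F a L = F a L.
Proof. by move=> am; rewrite /cut_arcs modn_small ?am // ltnW. Qed.

Lemma cut_arcs_family : arc_family N (cut_arcs F).
Proof.
have [Fper Flen Fnc] := famF; split=> [v L|v L|v L t L'].
- by rewrite /cut_arcs modnDr.
- by case/andP => _ /Flen; clear; lia.
case/andP; set a := v %% N => am FL tL.
have aL := Fle am FL; have atm : a + t < m by move: aL tL; clear; lia.
have -> : cut_arcs F (v + t) L' = F (a + t) L'.
  by rewrite /cut_arcs -modnDml modn_small ?atm // ltnW.
exact: Fnc.
Qed.

Lemma cut_arcs_label v L : v < m -> F v L -> label (cut_arcs F) v L = label F v L.
Proof.
move=> vm FL; have vL := Fle vm FL.
rewrite /label big_nat [RHS]big_nat; apply: eq_bigr => t tL; congr nat_of_bool.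
apply: eq_forallb => s; apply: eq_forallb => L'; rewrite cut_arcsE //.
by have := ltn_ord s; move: tL vL; clear; lia.
Qed.

Lemma cut_arcs_labels : all_labels N (cut_arcs F) = all_labels m F.
Proof.
have [_ Flen _] := famF.
rewrite /all_labels -[X in iota 0 X]addn1 iotaD map_cat flatten_cat add0n [X in _ ++ flatten X]/=.
have -> : labels_at N (cut_arcs F) m = [::].
  rewrite /labels_at /arcs_at (eq_in_filter (a2 := pred0)) ?filter_pred0 // => L _.
  by rewrite /cut_arcs modn_small ?ltnn.
rewrite cats0; congr flatten; apply/eq_in_map => v; rewrite mem_iota => /= vm.
have arcsE : arcs_at N (cut_arcs F) v = arcs_at m F v.
  transitivity (arcs_at N F v); first by apply: eq_filter => L; rewrite cut_arcsE.
  by apply: arcs_at_widen => // L /Flen/andP[].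
rewrite /labels_at arcsE; apply/eq_in_map => L; rewrite (mem_arcs_at famF) => FL.
by rewrite cut_arcs_label.
Qed.

(** With label sum [n] only the two ends of the root side stay uncovered, so there is no central
    piece. *)
Lemma cut_arcs_type la : sumn (all_labels m F) = n ->
  (chords_of n (cut_arcs F) \in dissections_of_type n la) = perm_eq (all_labels m F) la.
Proof.
move=> lab_sum; have famN := cut_arcs_family.
rewrite inE (dissection_chords_of famN cut_arcs_lt) /=.
have := piece_sizes famN cut_arcs_lt; have := card_central_cell famN.
rewrite cut_arcs_labels lab_sum => K.
have -> : (2 < #|central_cell n (cut_arcs F)|) = false.
  by move: K; move: #|_| => k; clear; lia.
rewrite cats0 => /permPl ->; apply/idP/idP => [|/perm_map]; last by apply.
by apply: perm_map_inj => x y [].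
Qed.

Lemma cut_arcs_chord v L : v < m -> L < m ->
  F v L = [&& 1 < L, v + L <= m & [set pt v; pt (v + L)] \in chords_of n (cut_arcs F)].
Proof.
move=> vm Lm; have [Fper Flen _] := famF; have famN := cut_arcs_family.
apply/idP/and3P => [FL|[L1 vL]].
  have L1 := Flen _ _ FL; split; [by case/andP: L1 | exact: Fle | ].
  by apply: (mem_chords_of famN) => //; rewrite cut_arcsE.
case/(chords_ofP famN cut_arcs_lt); first by move: L1 vL vm; clear; lia.
  by rewrite addKn cut_arcsE.
rewrite /cut_arcs modn_small; last by move: vL; clear; lia.
case/andP => vLm /(Fle vLm); move: vL L1 Lm; clear; lia.
Qed.

End Cut.

Lemma rooted_sum F : rooted F -> F 0 m -> sumn (all_labels m F) = n.
Proof.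
move=> [famF unc0] F0m; have := card_uncovered (ltn0Sn n) famF.
rewrite big_ltn // unc0 big_nat big1 ?addn0 => [|x xm]; first by case.
apply/eqP; rewrite eqb0 negbK; apply/(coveredP (ltn0Sn n) famF).
by exists 0, x, m.
Qed.

Lemma sum_rooted F : 0 < n -> rooted F -> sumn (all_labels m F) = n -> F 0 m.
Proof.
move=> n_gt0 [famF unc0] lab_sum; apply: (uncovered0_loop (ltn0Sn n) famF) => // x xm.
have := card_uncovered (ltn0Sn n) famF; rewrite lab_sum big_ltn // unc0 => e.
have {e} e : \sum_(1 <= i < m) ~~ covered m F i = 0 by move: e; move: (\sum_(1 <= _ < _) _) => y; clear; lia.
apply: contraT => unc; have x_in : x \in index_iota 1 m by rewrite mem_index_iota.
by move/eqP: e; rewrite (bigD1_seq x x_in (iota_uniq _ _)) /= unc.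
Qed.

(** The loop at [0] becomes the root side and is invisible among the diagonals; [sum_rooted]
    supplies it on both sides. *)
Lemma cut_arcs_inj F F' : 0 < n -> rooted F -> rooted F' ->
  sumn (all_labels m F) = n -> sumn (all_labels m F') = n ->
  chords_of n (cut_arcs F) = chords_of n (cut_arcs F') -> F = F'.
Proof.
move=> n_gt0 rF rF' sF sF' e; have F0 := sum_rooted n_gt0 rF sF; have F'0 := sum_rooted n_gt0 rF' sF'.
apply/funext => v; apply/funext => L.
have [[Fper Flen _] _] := rF; have [[Fper' Flen' _] _] := rF'.
rewrite -(@periodic_modn _ m (F^~ L)) // -(@periodic_modn _ m (F'^~ L)) //.
have : v %% m < m by rewrite ltn_mod.
move: (v %% m) => {}v vm; have [Lm|mL] := ltnP L m.
  by rewrite (cut_arcs_chord rF) // (cut_arcs_chord rF') // e.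
have [v0|v_gt0] := posnP v.
  rewrite v0; have [<-|Lm] := eqVneq m L; first by rewrite F0 F'0.
  by apply/idP/idP => [/Flen|/Flen']; move: mL Lm; clear; lia.
apply/idP/idP => FL; have [_ unc] := rF; have [_ unc'] := rF'; exfalso.
  have [fam _] := rF; have := uncovered0_arc (ltn0Sn n) fam unc vm FL.
  by move: mL v_gt0; clear; lia.
have [fam _] := rF'; have := uncovered0_arc (ltn0Sn n) fam unc' vm FL.
by move: mL v_gt0; clear; lia.
Qed.

(** The loop at [0] is added by hand, so that the piece at the root side is the cell of an arc
    too. *)
Definition rooted_arcs D v L := [&& 1 < L, v %% m + L <= m &
  (v %% m == 0) && (L == m) || ([set pt (v %% m); pt (v %% m + L)] \in D)].

Section OfDissection.
Variable D : {set {set 'I_N}}.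
Hypothesis disD : dissection D.

Lemma rooted_arcs_family : arc_family m (rooted_arcs D).
Proof.
split=> [v L|v L|v L t L'].
- by rewrite /rooted_arcs modnDr.
- by case/and3P => L1 vL _; move: L1 vL; move: (v %% m) => x; clear; lia.
rewrite /rooted_arcs -[(v + t) %% m]modnDml; move: (v %% m) => {}v.
case/and3P => L1 vL vD tL; have vt : v + t < m by move: vL tL; clear; lia.
rewrite (modn_small vt) => /and3P[L'1 vL' v'D].
case/orP: vD => [/andP[/eqP v0 /eqP Lm]|vD].
  by move: vL'; rewrite v0 Lm; clear; lia.
case/orP: v'D => [/andP[/eqP v0 _]|v'D].
  by move: v0 tL; clear; lia.
rewrite leqNgt; apply/negP => tL'; apply: (dissection_noncrossing disD _ _ vD v'D).
  by move: tL; clear; lia.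
by move: tL tL' vL'; clear; lia.
Qed.

Lemma rooted_arcs_rooted : rooted (rooted_arcs D).
Proof.
split; first exact: rooted_arcs_family.
apply/(coveredP (ltn0Sn n) rooted_arcs_family) => -[v [t [L [/and3P[_ vL _] tL]]]].
rewrite -modnDml mod0n modn_small; first by move: tL; clear; lia.
by move: vL tL; move: (v %% m) => x; clear; lia.
Qed.

Lemma rooted_arcs_loop : 0 < n -> rooted_arcs D 0 m.
Proof. by move=> n_gt0; rewrite /rooted_arcs mod0n !eqxx add0n leqnn /= andbT ltnS. Qed.

Lemma chords_of_rooted_arcs : chords_of n (cut_arcs (rooted_arcs D)) = D.
Proof.
have D_diag : {subset D <= diagonals setT} by case/andP: disD => /subsetP.
apply/setP => e; apply/idP/idP => [|eD].
  rewrite inE => /andP[e_diag /asboolP[v [L [/andP[vm]]]]].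
  rewrite /rooted_arcs (modn_small vm) => /and3P[L1 vL vD] eE.
  have eE' : e = [set pt (v %% N); pt (v %% N + L)].
    by rewrite eE; congr [set _; _]; apply/eqP; rewrite pt_eq ?modnDml ?modn_mod.
  case/orP: vD => [/andP[/eqP v0 /eqP Lm]|vD]; last by rewrite eE'.
  (* The chord of the loop is the root side, so it is not a diagonal. *)
  move: e_diag; rewrite in_setD eE' v0 Lm add0n setUC; case/andP => /negP[].
  have -> : pt 0 = pt m.+1 by exact: esym (ptD n 0).
  exact: side_edge.
have [a [b [ab ba aN bN eE]]] := dissection_chord disD eD.
have am : a < m by move: ab bN; clear; lia.
have abE : a + (b - a) = b by rewrite subnKC // ltnW // ltnW.
rewrite inE D_diag //; apply/asboolP; exists a, (b - a); rewrite abE; split=> //.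
rewrite /cut_arcs modn_small // am /rooted_arcs modn_small // abE -eE eD orbT andbT.
by move: ab bN; clear; lia.
Qed.

End OfDissection.

(** The factor [n + 1] from [card_families_around] turns the factorial of [n], due to the
    separators, into that of [n + 1]. *)
Lemma card_dissections la : 0 < n -> all (leq 1) la -> sumn la = n ->
  #|dissections_of_type n la| * (m`! * \prod_(1 <= i < m) (count_mem i la)`!) = (n + size la)`!.
Proof.
move=> n_gt0 la_pos la_sum.
have la_le : all (fun x => x <= n) la.
  apply/allP => x xla; rewrite -la_sum; elim: (la) xla => //= y s IH.
  by rewrite inE => /orP[/eqP->|/IH]; lia.
have la_lt : sumn la < m by rewrite la_sum.
have := card_families_count (ltn0Sn n) la_pos la_le la_lt.
rewrite card_families_around ?la_sum //= => <-.
suff -> : #|dissections_of_type n la| = #|families_around m 0 la|.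
  by rewrite factS; move: #|_| n`! (\prod_(_ <= _ < _) _) => x y z; rewrite -!mulnA mulnCA.
pose f (S : {set 'I_m * 'I_m.+1}) := chords_of n (cut_arcs (arcs_fun S)).
have fP S : S \in families_around m 0 la ->
    [/\ rooted (arcs_fun S), sumn (all_labels m (arcs_fun S)) = n & perm_eq (all_labels m (arcs_fun S)) la].
  rewrite !inE => /andP[/andP[/asboolP fam lab_la] unc]; split=> //.
  by rewrite (perm_sumn lab_la).
rewrite -(card_in_imset (f := f)) => [|S1 S2 /fP[r1 s1 _] /fP[r2 s2 _] e]; last first.
  by rewrite -(arcs_funK S1) -(arcs_funK S2) (cut_arcs_inj n_gt0 r1 r2 s1 s2 e).
apply: eq_card => D; apply/idP/imsetP => [D_type|[S /fP[rS sS lab_la] ->]].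
  have disD : dissection D by move: D_type; rewrite inE => /andP[].
  have rD := rooted_arcs_rooted disD; have [famD uncD] := rD.
  have DE := chords_of_rooted_arcs disD.
  exists (arcs_set m (rooted_arcs D)); last by rewrite /f arcs_setK // DE.
  rewrite !inE arcs_setK // uncD andbT; apply/andP; split; first exact/asboolP.
  by rewrite -(cut_arcs_type rD) ?DE //; apply: rooted_sum => //; apply: rooted_arcs_loop.
by rewrite /f cut_arcs_type.
Qed.

End Rooted.

(** * The q-multinomial coefficient and its values at roots of unity *)

Local Open Scope ring_scope.

Lemma qint_mulX1 a : ('X - 1) * qint a = 'X^a - 1.
Proof. by rewrite subrX1. Qed.

Lemma Cyclotomic1 : 'Phi_1 = 'X - 1.
Proof. by have := prod_Cyclotomic (ltn0Sn 0); rewrite big_seq1. Qed.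

(** Cancel ['Phi_1] in the factorization of ['X^a - 1]. The common bound [M] and the exponents 0 or
    1 let products for different [a] be multiplied factor by factor. *)
Lemma qint_Cyclotomic M a : (0 < a < M)%N ->
  qint a = \prod_(2 <= e < M) 'Phi_e ^+ (e %| a)%N.
Proof.
case/andP => a_gt0 aM; have X1_neq0 : 'X - 1 != 0 :> {poly int} by rewrite -polyC1 polyXsubC_eq0.
apply: (mulfI X1_neq0); rewrite qint_mulX1 -(prod_Cyclotomic a_gt0) -Cyclotomic1.
transitivity (\prod_(1 <= e < M) 'Phi_e ^+ (e %| a)%N); last by rewrite big_ltn ?dvd1n ?expr1 //; lia.
rewrite [RHS](bigID (fun e => e %| a)%N) /= [X in _ = _ * X]big1 ?mulr1 => [|e /negPf -> //].
transitivity (\prod_(1 <= e < M | (e %| a)%N) 'Phi_e); last by apply: eq_bigr => e ->; rewrite expr1.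
rewrite -[RHS]big_filter; apply: perm_big.
apply: uniq_perm; rewrite ?divisors_uniq ?filter_uniq ?iota_uniq // => e.
rewrite -dvdn_divisors // mem_filter mem_index_iota; case ea: (e %| a)%N => //=.
by have := dvdn_leq a_gt0 ea; have := dvdn_gt0 a_gt0 ea; lia.
Qed.

Lemma qfact_Cyclotomic M a : (a < M)%N -> qfact a = \prod_(2 <= e < M) 'Phi_e ^+ (a %/ e)%N.
Proof.
move=> aM; rewrite /qfact big_nat.
rewrite (eq_bigr (fun i => \prod_(2 <= e < M) 'Phi_e ^+ (e %| i)%N)) => [|i ia]; last first.
  by apply: qint_Cyclotomic; lia.
rewrite -big_nat exchange_big; apply: eq_bigr => e _ /=.
by rewrite prodrXr -divn_count_dvd.
Qed.

Lemma qint_neq0 a : (0 < a)%N -> qint a != 0.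
Proof.
move=> a_gt0; apply/eqP => qa0; have := qint_mulX1 a; rewrite qa0 mulr0 => /esym/eqP.
by apply/negP; rewrite -size_poly_eq0 size_XnsubC.
Qed.

Lemma qfact_neq0 a : qfact a != 0.
Proof.
rewrite /qfact big_nat prodf_seq_neq0; apply/allP => i _; apply/implyP => ia.
by apply: qint_neq0; lia.
Qed.

(* The inequality of multiplicities of [Phi_e]; it could only fail if [e] divided
   [n.+1] and all the [c i], hence also [n]. *)
Lemma divn_type n (c : nat -> nat) e : (1 < e)%N -> n = (\sum_(1 <= i < n.+1) i * c i)%N ->
  (n.+1 %/ e + \sum_(1 <= i < n.+1) c i %/ e <= (n + \sum_(1 <= i < n.+1) c i) %/ e)%N.
Proof.
move=> e_gt1 nE; have e_gt0 : (0 < e)%N by apply: ltnW.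
rewrite leq_divRL // mulnDl.
have [dvd_n1|ndvd_n1] := boolP (e %| n.+1)%N; last first.
  have lt_n1 : (n.+1 %/ e * e <= n)%N.
    by have := leq_trunc_div n.+1 e; rewrite leq_eqVlt -dvdn_eq (negPf ndvd_n1).
  by apply: leq_add => //; rewrite big_distrl /=; apply: leq_sum => i _; apply: leq_trunc_div.
have [j j_in ndvd_j] : exists2 j, j \in index_iota 1 n.+1 & ~~ (e %| c j)%N.
  apply/hasP; apply: contraT; rewrite -all_predC => /allP dvd_c.
  have : (e %| n)%N.
    rewrite {1}nE big_seq; apply: dvdn_sum => i /dvd_c /=; rewrite negbK => dvd_i.
    exact: dvdn_mull.
  by move=> dvd_n; move: dvd_n1 e_gt1; rewrite -addn1 (dvdn_addr _ dvd_n) dvdn1 => /eqP ->.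
rewrite (divnK dvd_n1) addSn -addnS leq_add2l big_distrl /=.
rewrite (bigD1_seq j j_in (iota_uniq _ _)) /= [X in (_ < X)%N](bigD1_seq j j_in (iota_uniq _ _)) /=.
rewrite -addSn; apply: leq_add; last by apply: leq_sum => i _; apply: leq_trunc_div.
by have := leq_trunc_div (c j) e; rewrite leq_eqVlt -dvdn_eq (negPf ndvd_j).
Qed.

(** The denominators [[n + 1]] and [[n]!] of [mu] merge into [[n + 1]!]; by [divn_type] no
    cyclotomic factor is left in the denominator. *)
Lemma type_polynomial n (c : nat -> nat) : n = (\sum_(1 <= i < n.+1) i * c i)%N ->
  exists P : {poly int}, P * (qfact n.+1 * \prod_(1 <= i < n.+1) qfact (c i)) =
    qfact (n + \sum_(1 <= i < n.+1) c i).
Proof.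
move=> nE; set l := (\sum_(1 <= i < n.+1) c i)%N.
pose M := (n + l).+2.
pose x e := (n.+1 %/ e + \sum_(1 <= i < n.+1) c i %/ e)%N.
exists (\prod_(2 <= e < M) 'Phi_e ^+ ((n + l) %/ e - x e)).
rewrite (@qfact_Cyclotomic M n.+1) ?(@qfact_Cyclotomic M (n + l)); [|by rewrite /M; lia..].
have -> : \prod_(1 <= i < n.+1) qfact (c i) =
    \prod_(2 <= e < M) 'Phi_e ^+ (\sum_(1 <= i < n.+1) c i %/ e).
  transitivity (\prod_(1 <= i < n.+1) \prod_(2 <= e < M) 'Phi_e ^+ (c i %/ e)).
    rewrite big_seq [RHS]big_seq; apply: eq_bigr => i i_in; apply: qfact_Cyclotomic.
    rewrite /M /l (bigD1_seq i i_in (iota_uniq _ _)) /=; move: (\sum_(_ <- _ | _) _)%N => y; lia.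
  by rewrite exchange_big; apply: eq_bigr => e _; rewrite prodrXr.
rewrite -!big_split /= big_nat [RHS]big_nat; apply: eq_bigr => e /andP[e_gt1 _].
by rewrite -!exprD subnK // divn_type.
Qed.

(** * Values at primitive roots of unity of order [d] *)

(** This is [[k]] at [q^d], the cofactor of [[d]] in [[d k]]. At a root of unity of order [d] its
    value is [k]. *)
Definition qpart d k : {poly int} := \sum_(j < k) 'X^(d * j).

Lemma qint_qpart d k : qint (d * k) = qint d * qpart d k.
Proof.
have X1_neq0 : 'X - 1 != 0 :> {poly int} by rewrite -polyC1 polyXsubC_eq0.
apply: (mulfI X1_neq0); rewrite mulrA !qint_mulX1 exprM subrX1.
by congr (_ * _); apply: eq_bigr => j _; rewrite exprM.
Qed.

Definition qfact_rest d a : {poly int} :=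
  \prod_(1 <= i < a.+1) if (d %| i)%N then qpart d (i %/ d) else qint i.

Lemma qfact_restE d a : qfact a = qint d ^+ (a %/ d) * qfact_rest d a.
Proof.
rewrite /qfact /qfact_rest divn_count_dvd -prodrXr -big_split /=; apply: eq_bigr => i _.
by case: ifP => [di|_]; rewrite ?mul1r // expr1 -qint_qpart mulnC divnK.
Qed.

Section Eval.
Variables (K : numFieldType) (z : K).

Definition qeval (p : {poly int}) : K := (map_poly intr p).[z].

Lemma evM p q : qeval (p * q) = qeval p * qeval q.
Proof. by rewrite /qeval rmorphM hornerM. Qed.

Lemma ev_prod (r : seq nat) (f : nat -> {poly int}) :
  qeval (\prod_(i <- r) f i) = \prod_(i <- r) qeval (f i).
Proof. by rewrite /qeval rmorph_prod horner_prod. Qed.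

Lemma ev_exp p k : qeval (p ^+ k) = qeval p ^+ k.
Proof. by rewrite /qeval rmorphXn horner_exp. Qed.

Lemma ev_sum (I : finType) (f : I -> {poly int}) : qeval (\sum_i f i) = \sum_i qeval (f i).
Proof. by rewrite /qeval rmorph_sum horner_sum. Qed.

Lemma ev_Xn k : qeval 'X^k = z ^+ k.
Proof. by rewrite /qeval map_polyXn hornerXn. Qed.

Lemma ev_qint a : qeval (qint a) = \sum_(i < a) z ^+ i.
Proof. by rewrite ev_sum; apply: eq_bigr => i _; rewrite ev_Xn. Qed.

Lemma ev_qfact1 a : z = 1 -> qeval (qfact a) = (a`!)%:R.
Proof.
move=> z1; rewrite ev_prod fact_prod natr_prod; apply: eq_bigr => i _.
by rewrite ev_qint z1; under eq_bigr do rewrite expr1n; rewrite sumr_const card_ord.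
Qed.

Section Root.
Variable d : nat.
Hypothesis d_gt1 : (1 < d)%N.
Hypothesis zd : z ^+ d = 1.
Hypothesis zj : forall j, (0 < j < d)%N -> z ^+ j != 1.

Let d_gt0 : (0 < d)%N. Proof. exact: ltnW. Qed.
Let z_neq1 : z - 1 != 0. Proof. by rewrite subr_eq0 -[z]expr1 zj. Qed.

Definition ev_qfact a := \prod_(1 <= i < a.+1) qeval (qint i).

Lemma ev_qint_neq0 j : (0 < j < d)%N -> qeval (qint j) != 0.
Proof.
move=> jd; rewrite ev_qint; apply/eqP => e; have := subrX1 z j.
by rewrite e mulr0 => /eqP; rewrite subr_eq0; apply/negP/zj.
Qed.

Lemma ev_qint_d : qeval (qint d) = 0.
Proof.
by apply: (mulfI z_neq1); rewrite ev_qint -subrX1 zd subrr mulr0.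
Qed.

Lemma ev_qint_mod a : qeval (qint a) = qeval (qint (a %% d)).
Proof.
apply: (mulfI z_neq1); rewrite !ev_qint -!subrX1 [in LHS](divn_eq a d) exprD mulnC exprM zd expr1n.
by rewrite mul1r.
Qed.

Lemma ev_qfact_neq0 a : (a < d)%N -> ev_qfact a != 0.
Proof.
move=> ad; rewrite /ev_qfact big_nat prodf_seq_neq0; apply/allP => i _; apply/implyP => ia.
by apply: ev_qint_neq0; lia.
Qed.

Lemma ev_qpart k : qeval (qpart d k) = k%:R.
Proof.
rewrite ev_sum; under eq_bigr do rewrite ev_Xn exprM zd expr1n.
by rewrite sumr_const card_ord.
Qed.

(** Values repeat with period [d]: each full period contributes [[1] ... [d-1]] and one multiple
    [d k], worth [k]; the last, incomplete period contributes the final factor. *)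
Lemma ev_qfact_rest a : qeval (qfact_rest d a) =
  ((a %/ d)`!)%:R * ev_qfact d.-1 ^+ (a %/ d) * ev_qfact (a %% d).
Proof.
rewrite /qfact_rest ev_prod; elim: a => [|a IH].
  by rewrite big_geq // div0n mod0n expr0 [ev_qfact 0]/ev_qfact big_geq // !mulr1.
rewrite big_nat_recr //= IH.
have [da|nda] := boolP (d %| a.+1)%N.
  have [k aE] := dvdnP da; case: k aE => // k aE.
  have qE : (a %/ d = k)%N.
    by rewrite (_ : a = k * d + d.-1)%N ?divnMDl ?divn_small ?addn0 //; lia.
  have rE : (a %% d = d.-1)%N by rewrite (_ : a = k * d + d.-1)%N ?modnMDl ?modn_small //; lia.
  have q1 : (a.+1 %/ d = k.+1)%N by rewrite aE mulnK.
  have r1 : (a.+1 %% d = 0)%N by rewrite aE modnMl.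
  rewrite qE rE q1 r1 ev_qpart factS natrM exprSr [ev_qfact 0]/ev_qfact big_geq // mulr1.
  by rewrite mulrC !mulrA.
have r_lt : ((a %% d).+1 < d)%N.
  rewrite ltn_neqAle ltn_mod d_gt0 andbT; apply: contra nda => /eqP e.
  by rewrite (divn_eq a d) -addnS e -mulSnr dvdn_mull.
have aE : (a.+1 = a %/ d * d + (a %% d).+1)%N by rewrite addnS -divn_eq.
have q1 : (a.+1 %/ d = a %/ d)%N by rewrite {1}aE divnMDl // (divn_small r_lt) addn0.
have r1 : (a.+1 %% d = (a %% d).+1)%N by rewrite {1}aE modnMDl (modn_small r_lt).
rewrite q1 r1 [qeval (qint _)]ev_qint_mod r1 -mulrA; congr (_ * _).
by rewrite [RHS]/ev_qfact big_nat_recr.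
Qed.

End Root.
End Eval.

Section RootValue.
Variables (K : numFieldType) (z : K) (n d m : nat) (c : nat -> nat) (P : {poly int}).
Hypothesis d_gt1 : (1 < d)%N.
Hypothesis zd : z ^+ d = 1.
Hypothesis zj : forall j, (0 < j < d)%N -> z ^+ j != 1.
Hypothesis dm : n.+2 = (d * m)%N.
Hypothesis nE : n = (\sum_(1 <= i < n.+1) i * c i)%N.
Hypothesis PE : P * (qfact n.+1 * \prod_(1 <= i < n.+1) qfact (c i)) =
    qfact (n + \sum_(1 <= i < n.+1) c i).

Let q := (\sum_(1 <= i < n.+1) c i %/ d)%N.
Let r := (\sum_(1 <= i < n.+1) c i %% d)%N.
Let w := ev_qfact z.

Let d_gt0 : (0 < d)%N. Proof. exact: ltnW. Qed.
Let m_gt0 : (0 < m)%N. Proof. by case: (m) dm => //; rewrite muln0. Qed.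

Let sum_c : (\sum_(1 <= i < n.+1) c i = q * d + r)%N.
Proof.
by rewrite /q /r big_distrl -big_split; apply: eq_bigr => i _ /=; rewrite -divn_eq.
Qed.

Let n1E : (n.+1 = m.-1 * d + d.-1)%N.
Proof. by case: (m) m_gt0 dm => // k _; rewrite mulnS [(d * k)%N]mulnC /=; lia. Qed.

Let div_n1 : (n.+1 %/ d = m.-1)%N.
Proof. by rewrite n1E divnMDl // divn_small ?addn0 //; lia. Qed.

Let mod_n1 : (n.+1 %% d = d.-1)%N.
Proof. by rewrite n1E modnMDl modn_small //; lia. Qed.

Let w_neq0 a : (a < d)%N -> w a != 0.
Proof. by apply: ev_qfact_neq0. Qed.

Let ev_rest a : qeval z (qfact_rest d a) = ((a %/ d)`!)%:R * w d.-1 ^+ (a %/ d) * w (a %% d).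
Proof. exact: ev_qfact_rest. Qed.

Let ev_rest_neq0 a : qeval z (qfact_rest d a) != 0.
Proof.
rewrite ev_rest !mulf_neq0 //; last by rewrite w_neq0 // ltn_mod.
  by rewrite pnatr_eq0 -lt0n fact_gt0.
by rewrite expf_neq0 // w_neq0 //; lia.
Qed.

Let le_exp : (m.-1 + q <= (n + \sum_(1 <= i < n.+1) c i) %/ d)%N.
Proof. by rewrite -div_n1; apply: divn_type. Qed.

(** The common power of [[d]] is cancelled among polynomials, as its value is 0. The surplus in the
    numerator becomes a power of 0, whose exponent separates the two cases. *)
Let ev_P : qeval z P * (qeval z (qfact_rest d n.+1) * \prod_(1 <= i < n.+1) qeval z (qfact_rest d (c i))) =
  0 ^+ ((n + \sum_(1 <= i < n.+1) c i) %/ d - (m.-1 + q)) *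
  qeval z (qfact_rest d (n + \sum_(1 <= i < n.+1) c i)).
Proof.
rewrite -(ev_qint_d d_gt1 zd zj) -ev_exp -ev_prod -!evM; congr (qeval z _).
apply: (mulfI (expf_neq0 (m.-1 + q) (qint_neq0 d_gt0))).
rewrite [RHS]mulrA -exprD subnKC // -qfact_restE -PE mulrCA; congr (_ * _).
rewrite (qfact_restE d n.+1) div_n1 exprD -!mulrA; congr (_ * _).
rewrite mulrCA; congr (_ * _).
rewrite [RHS](eq_bigr (fun i => qint d ^+ (c i %/ d) * qfact_rest d (c i))) => [|i _];
  last exact: qfact_restE.
by rewrite big_split /= prodrXr.
Qed.

Lemma ev_type_zero : (1 < r)%N -> qeval z P = 0.
Proof.
move=> r_gt1; have lt_exp : (m.-1 + q < (n + \sum_(1 <= i < n.+1) c i) %/ d)%N.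
  (* As [n] is 2 short of a multiple of [d], remainders with sum at least 2 complete one more
     multiple. *)
  have -> : (n + \sum_(1 <= i < n.+1) c i = (m.-1 + q).+1 * d + (r - 2))%N.
    by rewrite sum_c mulSn mulnDl; move: n1E; lia.
  by rewrite divnMDl // ltn_addr.
have := ev_P; rewrite -[X in 0 ^+ X]prednK ?subn_gt0 // expr0n /= mul0r => /eqP.
rewrite mulf_eq0 => /orP[/eqP//|].
rewrite mulf_eq0 (negPf (ev_rest_neq0 _)) /= prodf_seq_eq0 => /hasP[i _ /=].
by rewrite (negPf (ev_rest_neq0 _)).
Qed.

(** For [r = 1] the numerator leaves remainder [d - 1]. For [r = 0] all multiplicities, hence [n],
    are divisible by [d]; so is [n + 2], thus [d = 2], and the remainder 0 is harmless because
    [w 0 = w 1 = 1]. *)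
Let top_rest : (r <= 1)%N ->
  [/\ (n + \sum_(1 <= i < n.+1) c i) %/ d = m.-1 + q &
      w ((n + \sum_(1 <= i < n.+1) c i) %% d) = w d.-1]%N.
Proof.
move=> r_le1; have [r1|r0] : (r = 1)%N \/ (r = 0)%N by lia.
  have -> : (n + \sum_(1 <= i < n.+1) c i = (m.-1 + q) * d + d.-1)%N.
    by rewrite sum_c r1 mulnDl; move: n1E; lia.
  by rewrite divnMDl // modnMDl !modn_small ?divn_small ?addn0 //; lia.
have d_n : (d %| n)%N.
  rewrite nE big_seq; apply: dvdn_sum => i i_in; apply: dvdn_mull.
  apply/eqP; move/eqP: r0; rewrite /r (bigD1_seq i i_in (iota_uniq _ _)) /= addn_eq0.
  by case/andP => /eqP.
have d2 : d = 2%N.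
  have : (d %| 2)%N by rewrite -(dvdn_addr _ d_n) addn2 dm dvdn_mulr.
  by move/dvdn_leq => /(_ isT); lia.
have -> : (n + \sum_(1 <= i < n.+1) c i = (m.-1 + q) * d)%N.
  by rewrite sum_c r0 mulnDl; move: n1E; rewrite d2; lia.
rewrite mulnK // modnMl d2; split=> //; rewrite /w /ev_qfact big_geq // big_nat1.
by rewrite ev_qint big_ord1.
Qed.

Lemma ev_type_nonzero : (r <= 1)%N ->
  qeval z P * (m.-1`! * \prod_(1 <= i < n.+1) (c i %/ d)`!)%:R = ((m.-1 + q)`!)%:R.
Proof.
move=> r_le1; have [top_div top_mod] := top_rest r_le1.
have := ev_P; rewrite top_div subnn expr0 mul1r !ev_rest div_n1 mod_n1 top_div top_mod.
have -> : \prod_(1 <= i < n.+1) qeval z (qfact_rest d (c i)) =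
   (\prod_(1 <= i < n.+1) (c i %/ d)`!)%:R * w d.-1 ^+ q.
  rewrite /q -prodrXr natr_prod -big_split big_seq [RHS]big_seq; apply: eq_bigr => i i_in /=.
  rewrite ev_rest -[RHS]mulr1; congr (_ * _).
  (* The incomplete periods of the denominator disappear, since [w] is 1 at 0 and at 1. *)
  have : (c i %% d <= 1)%N.
    by apply: leq_trans r_le1; rewrite /r (bigD1_seq i i_in (iota_uniq _ _)) /= leq_addr.
  case: (c i %% d)%N => [|[|//]] _; first by rewrite /w /ev_qfact big_geq.
  by rewrite /w /ev_qfact big_nat1 ev_qint big_ord1.
have w0 : w d.-1 != 0 by rewrite w_neq0 //; lia.
set x := (\prod_(1 <= i < n.+1) _)%N => e.
apply: (mulIf (mulf_neq0 (expf_neq0 (m.-1 + q) w0) w0)).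
by rewrite [RHS]mulrA -e natrM exprD; ring.
Qed.

End RootValue.

(** * The complex number [e^(2 i pi / d)] *)

Section RootUnity.
Variable R : realType.

Lemma root_unityX d k : root_unity R d ^+ k =
  Complex (cos (2 * pi / d%:R *+ k)) (sin (2 * pi / d%:R *+ k)).
Proof.
elim: k => [|k IH]; first by rewrite expr0 mulr0n cos0 sin0.
rewrite exprS IH /root_unity [_ *+ k.+1]mulrS cosD sinD.
by apply/eqP; rewrite eq_complex /= eqxx /= [X in X == _]addrC mulrC [X in _ + X]mulrC.
Qed.

Lemma root_unity_order d : (0 < d)%N -> root_unity R d ^+ d = 1.
Proof.
move=> d_gt0; rewrite root_unityX -mulr_natr mulfVK ?pnatr_eq0 -?lt0n //.
by rewrite mulr_natl cos2pi sin2pi.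
Qed.

(** Real parts suffice: with [t = pi j / d] strictly between 0 and [pi], [cos (2 t) = 1] would force
    [sin t = 0]. *)
Lemma root_unity_primitive d j : (0 < j < d)%N -> root_unity R d ^+ j != 1.
Proof.
move=> jd; rewrite root_unityX eq_complex /= negb_and; apply/orP; left.
pose t : R := pi * (j%:R / d%:R).
have -> : 2 * pi / d%:R *+ j = t *+ 2.
  by rewrite /t -[LHS]mulr_natr -[RHS]mulr_natr; ring.
have t_int : 0 < t < pi.
  have d_gt0 : 0 < d%:R :> R by rewrite ltr0n; lia.
  have j_gt0 : 0 < j%:R :> R by rewrite ltr0n; case/andP: jd.
  apply/andP; split; first by rewrite mulr_gt0 ?pi_gt0 // divr_gt0.
  by rewrite gtr_pMr ?pi_gt0 // ltr_pdivrMr // mul1r ltr_nat; case/andP: jd.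
rewrite cos_mulr2n cos2sin2; apply/eqP => cos1; have := sin_gt0_pi t_int.
have /eqP : sin t ^+ 2 *+ 2 = 0 by rewrite -(subrr (1 : R)) -{2}cos1; ring.
by rewrite mulrn_eq0 /= expf_eq0 /= => /eqP ->; rewrite ltxx.
Qed.

Lemma root_unity1 : root_unity R 1 = 1.
Proof. by rewrite -[LHS]expr1 root_unity_order. Qed.

End RootUnity.

Lemma cancel_quotient (K : fieldType) (x a b c : K) : a != 0 -> b != 0 -> c != 0 ->
  x = a^-1 * (x * (b * a * c) / (c * b)).
Proof. by move=> a0 b0 c0; field; rewrite a0 b0 c0. Qed.

Theorem theorem5p2 (R : realType) (n : nat) (la : seq nat)
    (hn : (0 < n)%N) (hla : is_partition n la) :
  exists P : {poly int},
    tofrac P = mu n la /\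
    cyclic_sieving R (@rotation n) (dissections_of_type n la)
      [set: 'I_n.+2]%G P.
Proof.
have [la_pos la_sum] : all (leq 1) la /\ sumn la = n by case/and3P: hla => _ -> /eqP.
have la_le : all (fun x => x <= n)%N la.
  apply/allP => x xla; rewrite -la_sum; elim: (la) xla => //= y s IH.
  by rewrite inE => /orP[/eqP->|/IH]; lia.
pose c i := count_mem i la.
have c0 : c 0%N = 0%N.
  by apply/eqP; rewrite -leqn0 leqNgt -has_count has_pred1; apply/negP => /(allP la_pos).
have sum1 (f : nat -> nat) : f 0%N = 0%N -> (\sum_(i < n.+1) f i = \sum_(1 <= i < n.+1) f i)%N.
  by move=> f0; rewrite -(big_mkord predT f) [LHS]big_ltn // f0.
have nE : n = (\sum_(1 <= i < n.+1) i * c i)%N.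
  by rewrite -{1}la_sum (sumn_count la_le) (sum1 (fun i => i * c i)%N).
have size_la : (\sum_(1 <= i < n.+1) c i = size la)%N.
  by rewrite (size_count la_le) (sum1 c).
have [P PE] := type_polynomial nE; exists P; split.
  have qfact_n : qfact n.+1 = qfact n * qint n.+1 by rewrite /qfact big_nat_recr.
  have prodE : tofrac (\prod_(1 <= i < n.+1) qfact (c i)) = \prod_(1 <= i < n.+1) tofrac (qfact (c i)).
    exact: rmorph_prod.
  have := congr1 (@tofrac _) PE; rewrite size_la tofracM tofracM prodE qfact_n tofracM => PE'.
  rewrite /mu /qmultinomial -PE' -cats1 big_cat big_seq1 big_map /=.
  rewrite (_ : iota 1 n = index_iota 1 n.+1); last by rewrite /index_iota subn1.
  have A0 : tofrac (qint n.+1) != 0 by rewrite tofrac_eq0 qint_neq0.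
  have B0 : tofrac (qfact n) != 0 by rewrite tofrac_eq0 qfact_neq0.
  have C0 : \prod_(1 <= i < n.+1) tofrac (qfact (c i)) != 0.
    by rewrite prodf_seq_neq0; apply/allP => i _; rewrite tofrac_eq0 qfact_neq0.
  by rewrite {1}(cancel_quotient (tofrac P) A0 B0 C0); congr (_ * (_ / (_ * _))).
split; [exact: rotation_cyclic | exact: rotation_acts | move=> g _].
have := order_dvd g; set d := #[g]%g => /dvdnP[m]; rewrite mulnC => dm.
rewrite (fix_rotation _ dm) // -/(qeval _ P).
have d_gt0 : (0 < d)%N by rewrite order_gt0.
have [d1|d_neq1] := eqVneq d 1%N.
  rewrite d1 root_unity1.
  have -> : [set D in dissections_of_type n la | rot_chords m D == D] = dissections_of_type n la.
    apply/setP => D; rewrite inE; case: (D \in _) => //=; apply/eqP.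
    have mN : m = n.+2 by rewrite dm d1 mul1n.
    rewrite /rot_chords -[RHS]imset_id; apply: eq_imset => e.
    rewrite /rot_set -[RHS]imset_id; apply: eq_imset => x.
    by rewrite (_ : pt n m = 0) ?addr0 //; apply/val_inj; rewrite /= mN modnn.
  (* At [q = 1] the defining identity of [P] becomes the product form of the number of all
     dissections. *)
  have := congr1 (qeval (1 : R[i])) PE; rewrite evM evM ev_prod !ev_qfact1 // size_la.
  under eq_bigr do rewrite ev_qfact1 //.
  rewrite -natr_prod -natrM -(card_dissections hn la_pos la_sum) [RHS]natrM => e.
  apply: mulIf e; rewrite pnatr_eq0 -lt0n muln_gt0 fact_gt0 /=.
  by apply: prodn_gt0 => i; rewrite fact_gt0.
have d_gt1 : (1 < d)%N by rewrite ltn_neqAle eq_sym d_neq1.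
have zd := root_unity_order R d_gt0.
have zj j : (0 < j < d)%N -> root_unity R d ^+ j != 1 by exact: root_unity_primitive.
have := card_fixed dm d_gt1 la_pos la_sum.
rewrite (sum1 (fun i => c i %% d)%N) ?c0 ?mod0n //.
(* Count and evaluation split on the same sum of remainders: above 1 both vanish, otherwise both
   solve the same linear equation. *)
have [r_le1 count|r_gt1 ->] := leqP; last by rewrite (ev_type_zero d_gt1 zd zj dm nE PE).
have := ev_type_nonzero d_gt1 zd zj dm nE PE r_le1; rewrite -count [RHS]natrM => e.
apply: mulIf e; rewrite pnatr_eq0 -lt0n muln_gt0 fact_gt0 /=.
by apply: prodn_gt0 => i; rewrite fact_gt0.
Qed.
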